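(* Let $W$ be an observation window and $a=(a_0,\dots,a_\alpha)\in\mathbb R^{\alpha+1}$. The expectation and variance of the generalized Euler characteristic $\chi_a(\Delta_W)$ are given by $$\mathbb E[\chi_a(\Delta_W)]=\sum_{m=1}^{\alpha+1}a_{m-1}\frac{\beta^m}{m!}\,I_{m,m}^m(W),$$ $$\mathbb V(\chi_a(\Delta_W))=\sum_{m,l=1}^{\alpha+1}\;\sum_{r=\max\{m,l\}}^{m+l-1}a_{m-1}a_{l-1}\frac{\beta^r}{(r-m)!\,(r-l)!\,(m+l-r)!}\,I_{m,l}^r(W).$$
   Context: **Model.** $(\mathbb X,\mathcal X)$ is a Borel space (measurably isomorphic to a Borel subset of $[0,1]$) with a $\sigma$-finite diffuse measure $\lambda$. Fix $\alpha\in\{1,2,\dots\}$, $\beta>0$ and measurable symmetric functions $\varphi_j:\mathbb X^{j+1}\to[0,1]$, $1\le j\le\alpha$ (connection functions), and put $\varphi_0\equiv1$. An observation window is a measurable $W\subseteq\mathbb X$ with $0<\lambda(W)<\infty$. Let $\Phi$ be a Poisson process on $\mathbb X$ with intensity measure $\beta\lambda$. Given $\Phi$, attach to each set $\sigma$ of $2\le|\sigma|\le\alpha+1$ points of $\Phi$ a uniform $[0,1]$ variable $U_\sigma$, all independent. The random simplicial complex $\Delta$ has the points of $\Phi$ as vertices (singletons), and a set $\sigma$ of $2\le|\sigma|\le\alpha+1$ points belongs to $\Delta$ iff $U_\rho\le\varphi_{|\rho|-1}(\rho)$ for all $\rho\subseteq\sigma$ with $|\rho|\ge2$, where $\varphi_{|\rho|-1}(\rho)$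 is the value at the points of $\rho$; no larger simplices occur. $\Delta_W$ is the subcomplex of simplices with all vertices in $W$. **Euler characteristic.** $f_j(K)$ is the number of $j$-simplices (elements with $j+1$ vertices) of $K$; for finite $K$, $\chi_a(K):=\sum_{i=0}^{\dim K}a_if_i(K)$ with $a_i=0$ for $i>\alpha$. **Integrals.** For $m,l\in\{1,\dots,\alpha+1\}$ and $\max\{m,l\}\le r\le m+l$, let $K_{m,l}^r$ be the simplicial complex on $\{1,\dots,r\}$ consisting of all nonempty subsets of $\{1,\dots,m\}$ and all nonempty subsets of $\{1,\dots,m+l-r,\,m+1,\dots,r\}$ (two simplices with $m$ and $l$ vertices sharing $m+l-r$ vertices), $\kappa_{m,l}^r(x_1,\dots,x_r):=\prod_{\sigma\in K_{m,l}^r}\varphi_{|\sigma|-1}(x_\sigma)$, where $x_\sigma$ denotes the points $x_i$, $i\in\sigma$, and $I_{m,l}^r(W):=\int_{W^r}\kappa_{m,l}^r(x_1,\dots,x_r)\,\lambda^r(\mathrm d(x_1,\dots,x_r))$. *)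

(* Defs.v *)
From HB Require Import structures.
From mathcomp Require Import all_boot all_order all_algebra all_fingroup.
From mathcomp Require Import finmap.
From mathcomp Require Import all_classical all_reals all_analysis.
From mathcomp Require Import measurable_realfun.

Set Implicit Arguments.
Unset Strict Implicit.
Unset Printing Implicit Defensive.

Import Order.TTheory GRing.Theory Num.Theory.
Import numFieldNormedType.Exports.

Local Open Scope classical_set_scope.
Local Open Scope ring_scope.

Section product_measure.
Context {d} {X : measurableType d} {R : realType}.
Implicit Type n : nat.

Definition cons_pair n (p : X * n.-tuple X) : n.+1.-tuple X :=
  [tuple of p.1 :: p.2].

Lemma measurable_cons_pair n : measurable_fun setT (@cons_pair n).
Proof. exact: (measurable_cons measurable_fst measurable_snd). Qed.

Variable lambda : {sigma_finite_measure set X -> \bar R}.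

Definition cons_measure n (m : {sigma_finite_measure set (n.-tuple X) -> \bar R})
    : set (n.+1.-tuple X) -> \bar R :=
  pushforward (lambda \x m)%E (@cons_pair n).

Section cons_measure_sigma_finite.
Context n (m : {sigma_finite_measure set (n.-tuple X) -> \bar R}).

Let cons_measure0 : cons_measure m set0 = 0%E.
Proof. by rewrite /cons_measure /pushforward preimage_set0 measure0. Qed.

Let cons_measure_ge0 A : (0 <= cons_measure m A)%E.
Proof. by rewrite /cons_measure /pushforward measure_ge0. Qed.

Let cons_measure_sigma_additive : semi_sigma_additive (cons_measure m).
Proof.
move=> F mF tF mUF; rewrite /cons_measure /pushforward preimage_bigcup.
have mcons A : measurable A -> measurable (@cons_pair n @^-1` A).
  by move=> mA; rewrite -[X in measurable X]setTI; exact: measurable_cons_pair.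
apply: measure_semi_sigma_additive.
- by move=> k; exact: mcons.
- apply/trivIsetP => /= i j _ _ ij; rewrite -preimage_setI.
  by move/trivIsetP : tF => /(_ _ _ _ _ ij) ->//; rewrite preimage_set0.
- by rewrite -preimage_bigcup; exact: mcons.
Qed.

HB.instance Definition _ := isMeasure.Build _ _ _ (cons_measure m)
  cons_measure0 cons_measure_ge0 cons_measure_sigma_additive.

Lemma sigma_finite_cons_measure : sigma_finite setT (cons_measure m).
Proof.
have /sigma_finiteP[F [TF ndF Foo]] := sigma_finiteT lambda.
have /sigma_finiteP[G [TG ndG Goo]] := sigma_finiteT m.
pose uncons (t : n.+1.-tuple X) : X * n.-tuple X := (thead t, [tuple of behead t]).
have muncons : measurable_fun setT uncons.
  by apply: measurable_fun_pair; [exact: measurable_tnth|exact: measurable_behead].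
exists (fun k => uncons @^-1` (F k `*` G k)).
  apply/seteqP; split => // t _.
  have [i _ Fi] : (\bigcup_i F i) (thead t) by rewrite -TF.
  have [j _ Gj] : (\bigcup_i G i) [tuple of behead t] by rewrite -TG.
  exists (maxn i j) => //; split => /=.
  - by move: Fi; exact/subsetPset/ndF/leq_maxl.
  - by move: Gj; exact/subsetPset/ndG/leq_maxr.
move=> k; have [mF Fk] := Foo k; have [mG Gk] := Goo k; split.
  rewrite -[X in measurable X]setTI; apply: muncons => //.
  exact: measurableX.
rewrite /cons_measure /pushforward (_ : _ @^-1` _ = F k `*` G k); last first.
  by apply/funext => -[x t]; rewrite /uncons /preimage/= theadE;
     congr (_ /\ G k _); exact/val_inj.
by rewrite product_measure1E// lte_mul_pinfty// ge0_fin_numE.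
Qed.

HB.instance Definition _ :=
  Measure_isSigmaFinite.Build _ _ _ (cons_measure m) sigma_finite_cons_measure.
End cons_measure_sigma_finite.

Fixpoint power_measure n : {sigma_finite_measure set (n.-tuple X) -> \bar R} :=
  if n is n'.+1 then cons_measure (power_measure n') else \d_[tuple].

End product_measure.

(* The last two conditions say that [f] is a measurable isomorphism from [X]
   onto a Borel subset of [0, 1]: [f @` setT] is Borel, and the inverse of [f]
   is measurable. *)
Definition borel_space {d} (X : measurableType d) (R : realType) :=
  exists f : X -> R, [/\ injective f, range f `<=` `[0, 1],
    measurable_fun setT f & forall A, measurable A -> measurable (f @` A)].

Definition diffuse {d} {X : measurableType d} {R : realType}
    (lambda : set X -> \bar R) :=
  forall x, lambda [set x] = 0%E.

Section connection_functions.
Context {d} {X : measurableType d} {R : realType}.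
Implicit Type phi : forall j, j.+1.-tuple X -> R.

Definition connection_functions (alpha : nat) phi :=
  (forall t, phi 0%N t = 1) /\
  forall j, (1 <= j <= alpha)%N ->
    [/\ measurable_fun setT (phi j),
        forall t, 0 <= phi j t <= 1 &
        forall (t : j.+1.-tuple X) (s : 'S_j.+1),
          phi j [tuple tnth t (s i) | i < j.+1] = phi j t].

(* The value of [phi (size s).-1] at the points listed in [s]. By symmetry of
   the connection functions the order of [s] is irrelevant; the case of the
   empty list is never used. *)
Definition connection_at phi (s : seq X) : R :=
  if s is x :: s' then phi (size s') [tuple of x :: in_tuple s'] else 1.

End connection_functions.

Definition mutually_independent {d} {Omega : measurableType d} {R : realType}
    (P : probability Omega R) (I : choiceType) (D : set I)
    (F : I -> set (set Omega)) :=
  forall (J : {fset I}) (E : I -> set Omega),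
    [set` J] `<=` D -> (forall i, i \in J -> F i (E i)) ->
    P (\bigcap_(i in [set` J]) E i) = (\prod_(i <- J) P (E i))%E.

Section poisson_process.
Context {d} {X : measurableType d} {R : realType}.
Context {d'} {Omega : measurableType d'}.

(* Its law at a set of finite intensity is written out, as the library's
   [poisson_pmf] is constantly 1 for the parameter 0. *)
Definition poisson_process (P : probability Omega R) (mu : set X -> \bar R)
    (eta : Omega -> set X -> \bar R) :=
  [/\ forall B, measurable B -> measurable_fun setT (eta ^~ B),
      forall B k, measurable B -> (mu B < +oo)%E ->
        P [set w | eta w B = k%:R%:E] =
        (expR (- fine (mu B)) * fine (mu B) ^+ k / k`!%:R)%:E,
      forall B, measurable B -> mu B = +oo%E ->
        P [set w | eta w B = +oo%E] = 1%E &
      forall n (B : 'I_n -> set X),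
        (forall i, measurable (B i)) -> trivIset setT B ->
        mutually_independent P setT
          (fun i => g_sigma_algebra_preimage (fun w => eta w (B i)))].

Implicit Types (N : Omega -> \bar R) (pt : nat -> Omega -> X).

(* The sum of the Dirac measures at the points [pt n w], [n < N w]. *)
Definition point_measure N pt (w : Omega) (B : set X) : \bar R :=
  (\sum_(0 <= n <oo | n%:R%:E < N w) \d_(pt n w) B)%E.

(* A Poisson process on a Borel space is given through a measurable enumeration
   of its points; [N] is their number, possibly infinite. *)
Definition enumerated_poisson_process (P : probability Omega R)
    (mu : set X -> \bar R) N pt :=
  [/\ measurable_fun setT N,
      forall w, N w = +oo%E \/ exists k : nat, N w = k%:R%:E,
      forall n, measurable_fun setT (pt n) &
      poisson_process P mu (point_measure N pt)].

Definition sigma_points N pt : set (set Omega) :=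
  <<s g_sigma_algebra_preimage N
      `|` \bigcup_n g_sigma_algebra_preimage (pt n) >>.

(* [U J] is the mark of the set of points [pt n], [n \in J]. The marks are
   independent of each other and, jointly, of the enumerated process; the
   latter is the member [None] of the family. *)
Definition uniform_marks (P : probability Omega R) (alpha : nat) N pt
    (U : {fset nat} -> Omega -> R) :=
  let D := [set J : {fset nat} | (2 <= #|` J| <= alpha.+1)%N] in
  [/\ forall J, D J -> measurable_fun setT (U J),
      forall J A, D J -> measurable A ->
        P (U J @^-1` A) = uniform_prob (@ltr01 R) A &
      mutually_independent P (None |` (Some @` D))
        (fun o : option {fset nat} =>
           if o is Some J then g_sigma_algebra_preimage (U J)
           else sigma_points N pt)].

End poisson_process.

Section random_complex.
Context {d} {X : measurableType d} {R : realType}.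
Context {d'} {Omega : measurableType d'}.

(* The simplices are sets of points. Almost surely the points are pairwise
   distinct, so that [J] is determined by [s]. *)
Definition random_complex (alpha : nat) (phi : forall j, j.+1.-tuple X -> R)
    (N : Omega -> \bar R) (pt : nat -> Omega -> X)
    (U : {fset nat} -> Omega -> R) (w : Omega) : set {fset X} :=
  [set s | (1 <= #|` s| <= alpha.+1)%N /\
    exists J : {fset nat},
      [/\ forall n, n \in J -> (n%:R%:E < N w)%E,
          s = [fset pt n w | n in J]%fset,
          #|` s| = #|` J| &
          forall K : {fset nat}, (K `<=` J)%fset -> (2 <= #|` K|)%N ->
            U K w <= connection_at phi [seq pt n w | n <- K]]].

End random_complex.

Section simplicial_complex.
Context {X : choiceType} {R : realType}.
Implicit Type K : set {fset X}.

Definition subcomplex (W : set X) K : set {fset X} :=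
  [set s | K s /\ [set` s] `<=` W].

Definition nb_simplices (j : nat) K : nat :=
  #|` fset_set [set s | K s /\ #|` s| = j.+1]|.

(* [dim K + 1], for finite [K] *)
Definition max_vertices K : nat := \max_(s <- fset_set K) #|` s|.

Definition euler_char (a : nat -> R) K : R :=
  \sum_(0 <= i < max_vertices K) a i * (nb_simplices i K)%:R.

End simplicial_complex.

Section simplex_integral.
Context {d} {X : measurableType d} {R : realType}.
Context (lambda : {sigma_finite_measure set X -> \bar R}).
Context (phi : forall j, j.+1.-tuple X -> R).

(* The vertices are numbered from 0: the two simplices have the vertices
   [0 .. m - 1] and [0 .. m + l - r - 1, m .. r - 1]. *)
Definition two_simplices (m l r : nat) : {set {set 'I_r}} :=
  [set s : {set 'I_r} | (s != finset.set0) &&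
    ((s \subset [set i : 'I_r | (i < m)%N]%SET) ||
     (s \subset [set i : 'I_r | (i < m + l - r)%N || (m <= i)%N]%SET))]%SET.

Definition kappa (m l r : nat) (x : r.-tuple X) : R :=
  \prod_(s in two_simplices m l r)
    connection_at phi [seq tnth x i | i <- enum s].

Definition simplex_integral (m l r : nat) (W : set X) : \bar R :=
  (\int[power_measure lambda r]_(x in [set x | forall i, W (tnth x i)])
     (kappa m l x)%:E)%E.

End simplex_integral.

(* Main.v *)
Require Import Defs.
From HB Require Import structures.
From mathcomp Require Import all_boot all_order all_algebra.
From mathcomp Require Import finmap.
From mathcomp Require Import all_classical all_reals all_analysis.
From mathcomp Require Import measurable_realfun.
From mathcomp Require Import perm ring lra zify.

Import Order.TTheory GRing.Theory Num.Theory.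
Import numFieldNormedType.Exports.

Local Open Scope classical_set_scope.
Local Open Scope ring_scope.

(** Let F_m be the number of sets of m indices whose points span a simplex with
    all its vertices in W. Almost surely the points are pairwise distinct, so
    that the Euler characteristic is the sum of the a_(m-1) F_m. Everything
    follows from the mixed moments E[F_m F_l] for m, l <= alpha + 1,
    [face_count_moment]: they are sums over r, from max (m, l) to m + l, of the
    terms of the variance formula. Since F_0 = 1, the expectation of F_m is the
    case l = 0; and the term r = m + l is E[F_m] E[F_l], because two simplices
    without common vertex have no common face, so that it disappears from the
    covariance.

    For the mixed moment, F_m F_l is a sum over pairs of index sets. A pair
    whose union has r elements is described by (r-m)! (r-l)! (m+l-r)! lists of r
    distinct indices, [esum_overlapping]. Given the points, the two simplices
    that such a list describes are present with probability kappa, because every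
    face with at least two vertices, be it in one simplex or in both, requires
    one independent uniform mark to be below its threshold, [probability_pair].
    It remains to sum the expectation of a function of the listed points over
    all lists of r distinct indices, which gives beta^r times its integral for
    the r-th power of lambda, [factorial_moment].

    This last formula is derived from the counts of points in sets, as the law
    of the enumeration itself is not given. Both sides, as functions of the
    integrand, are measures on the r-tuples of points of W. On a rectangle with
    disjoint sides in W they agree by independence of the counts and the mean of
    the Poisson law. Such rectangles generate the sigma-algebra up to the tuples
    with a repeated entry, which are negligible on both sides: for the powers of
    lambda since it is diffuse, and for the process by [double_point_null],
    where W is cut into ever smaller cells and the probability of two points in
    a cell C is at most mu(C)^2.

    Measurability of the Euler characteristic holds everywhere, including where
    points coincide and a simplex is given by several sets of indices. There the
    set of indices of least code stands for the simplex, [first_preimage]. *)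

(** * Nonnegative sums over countable types *)

Section countable_sums.
Context {R : realType}.
Local Open Scope ereal_scope.

(** Numbering the index type through its codes turns the sum into a series,
    for which monotone convergence is available. *)
Lemma esum_nneseries {T : countType} (a : T -> \bar R) :
  (forall i, 0 <= a i) ->
  \esum_(i in [set: T]) a i =
  \sum_(0 <= k <oo) oapp a 0 (pickle_inv k : option T).
Proof.
move=> a0; have a0' k : 0 <= oapp a 0 (pickle_inv k : option T).
  by case: pickle_inv.
rewrite nneseries_esumT//.
have -> : \esum_(i in [set: nat]) oapp a 0 (pickle_inv i : option T) =
          \esum_(k in (@choice.pickle T) @` setT) oapp a 0 (pickle_inv k).
  rewrite [RHS]esum_mkcond; apply: eq_esum => k _; case: ifPn => // /negP kP.
  case: pickle_inv (@pickle_invK T k) => //= t tk.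
  by exfalso; apply: kP; rewrite inE; exists t.
rewrite esum_image; last by move=> x y _ _ /(pcan_inj choice.pickleK).
by apply: eq_esum => i _; rewrite pickleK_inv.
Qed.

Lemma measurable_esum {d} {Y : measurableType d} {T : countType}
    (f : T -> Y -> \bar R) (D : set Y) : measurable D ->
  (forall i y, 0 <= f i y) -> (forall i, measurable_fun D (f i)) ->
  measurable_fun D (fun y => \esum_(i in [set: T]) f i y).
Proof.
move=> mD f0 mf; under eq_fun do rewrite esum_nneseries//.
have mg k : measurable_fun D
    (fun y => oapp (f ^~ y) 0 (pickle_inv k : option T)).
  by case: pickle_inv => //=; exact: measurable_cst.
apply: (@ge0_emeasurable_sum _ _ _ D
  (fun k y => oapp (f ^~ y) 0 (pickle_inv k : option T)) xpredT) => //.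
by move=> k y Dy _; case: pickle_inv => /=.
Qed.

Lemma integral_esum {d} {Y : measurableType d} (mu : {measure set Y -> \bar R})
    {T : countType} (f : T -> Y -> \bar R) (D : set Y) : measurable D ->
  (forall i y, 0 <= f i y) -> (forall i, measurable_fun D (f i)) ->
  \int[mu]_(y in D) (\esum_(i in [set: T]) f i y) =
  \esum_(i in [set: T]) \int[mu]_(y in D) f i y.
Proof.
move=> mD f0 mf; under eq_integral do rewrite esum_nneseries//.
rewrite integral_nneseries//; last 2 first.
- by move=> k; case: pickle_inv => /= *; [exact: mf|exact: measurable_cst].
- by move=> k y _; case: pickle_inv => /=.
rewrite esum_nneseries; last by move=> i; exact: integral_ge0.
by apply: eq_eseriesr => k _; case: pickle_inv => //=; rewrite integral0.
Qed.

(** For an infinite factor both sides are 0 or [+oo], according as all the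
    terms vanish or not. *)
Lemma ge0_esumZl {T : choiceType} (D : set T) (c : \bar R) (a : T -> \bar R) :
  0 <= c -> (forall i, 0 <= a i) ->
  \esum_(i in D) (c * a i) = c * \esum_(i in D) a i.
Proof.
move=> c0 a0; have mono t (b : T -> \bar R) : D t -> (forall i, 0 <= b i) ->
    b t <= \esum_(i in D) b i.
  move=> Dt b0; apply: esum_ge; exists [set t]; last by rewrite fsbig_set1.
  by split; [exact: finite_set1|move=> _ ->].
case: c c0 => [r r0| _ |//].
  rewrite /esum -ereal_supZl//; last first.
    by apply/set0P; exists (\sum_(i \in set0) a i), set0 => //;
       exact: fsets_set0.
  congr ereal_sup; apply/seteqP; split => [_ [A AD <-]|_ [_ [A AD <-] <-]].
    by exists (\sum_(i \in A) a i); [exists A|rewrite ge0_mule_fsumr].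
  by exists A => //; rewrite ge0_mule_fsumr.
have [[t [Dt at0]]|] := pselect (exists t, D t /\ 0 < a t).
  rewrite gt0_mulye; last exact: lt_le_trans at0 (mono _ _ Dt a0).
  apply/eqP; rewrite -leye_eq -[leLHS](gt0_mulye at0).
  by apply: (mono t (fun i => +oo * a i)) => // i; rewrite mule_ge0.
move/forallNP => at0.
have {}at0 t : D t -> a t = 0.
  move=> Dt; apply/eqP; have /not_andP[//|/negP] := at0 t.
  by rewrite lt_neqAle a0 andbT negbK eq_sym.
by rewrite !esum1 ?mule0// => t Dt; rewrite at0 ?mule0.
Qed.

Lemma ge0_esumZr {T : choiceType} (D : set T) (c : \bar R) (a : T -> \bar R) :
  0 <= c -> (forall i, 0 <= a i) ->
  \esum_(i in D) (a i * c) = (\esum_(i in D) a i) * c.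
Proof.
by move=> c0 a0; rewrite muleC -ge0_esumZl//; apply: eq_esum => i _; exact: muleC.
Qed.

Lemma esum_tuple0 {T : choiceType} (F : 0.-tuple T -> \bar R) :
  (forall t, 0 <= F t) -> \esum_(t in [set: 0.-tuple T]) F t = F [tuple].
Proof.
move=> F0; rewrite -(esum_set1 (F0 [tuple])); congr esum.
by apply/seteqP; split=> // t _ /=; rewrite tuple0.
Qed.

Lemma esum_tupleS {T : choiceType} n (F : n.+1.-tuple T -> \bar R) :
  (forall t, 0 <= F t) ->
  \esum_(t in [set: n.+1.-tuple T]) F t =
  \esum_(x in [set: T]) \esum_(t in [set: n.-tuple T]) F [tuple of x :: t].
Proof.
move=> F0; rewrite esum_esum//.
apply: (reindex_esum _ _ (fun p : T * n.-tuple T => [tuple of p.1 :: p.2])).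
split => //= [[x s] [y t] _ _ /= /(congr1 val)/= [-> /val_inj ->]//|t _].
by exists (thead t, [tuple of behead t]) => //=; rewrite -tuple_eta.
Qed.

Lemma esum_tuple_prod {T : choiceType} n (f : 'I_n -> T -> \bar R) :
  (forall i t, 0 <= f i t) ->
  \esum_(t in [set: n.-tuple T]) \prod_(i < n) f i (tnth t i) =
  \prod_(i < n) \esum_(x in [set: T]) f i x.
Proof.
elim: n f => [|n IHn] f f0.
  by rewrite esum_tuple0 => [|t]; rewrite ?big_ord0// big_ord0.
rewrite esum_tupleS; last by move=> t; apply: prode_ge0.
rewrite big_ord_recl -IHn// -ge0_esumZr//; last first.
  by apply: esum_ge0 => t _; apply: prode_ge0.
apply: eq_esum => x _; rewrite -ge0_esumZl//; last first.
  by move=> t; apply: prode_ge0.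
apply: eq_esum => t _; rewrite big_ord_recl; congr (_ * _).
by apply: eq_bigr => i _; congr (f _ _); rewrite tnthS.
Qed.

End countable_sums.

Section counting.
Context {R : realType}.
Local Open Scope ereal_scope.

Lemma eq_indic {T U : Type} (A : set T) (B : set U) x y :
  (A x <-> B y) -> \1_A x = \1_B y :> R.
Proof.
move=> AB; rewrite !indicE; congr (_%:R)%R; congr nat_of_bool.
by apply/idP/idP => /set_mem ?; apply/mem_set; apply/AB.
Qed.

Lemma esum_one {T : choiceType} (S : set T) :
  \esum_(i in S) (1 : \bar R) =
  if pselect (finite_set S) then (#|` fset_set S|%:R)%:E else +oo.
Proof.
case: pselect => [fS|iS].
  rewrite -[in LHS](fset_setK fS) esum_fset// fsbig_finite// set_fsetK.
  by rewrite sumEFin big_const_seq count_predT iter_addr addr0.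
apply: eq_infty => M.
have [B BS nB] := infinite_set_fset (Num.truncn M).+1 iS.
apply: esum_ge; exists [set` B]; first by split => //; exact: finite_fset.
rewrite fsbig_finite// set_fsetK sumEFin big_const_seq count_predT.
by rewrite iter_addr addr0 lee_fin (le_trans (ltW (truncnS_gt M)))// ler_nat.
Qed.

Lemma esum_indic {T : choiceType} (S : set T) :
  \esum_(i in [set: T]) (\1_S i : R)%:E = \esum_(i in S) (1 : \bar R).
Proof.
by rewrite [RHS]esum_mkcond; apply: eq_esum => i _; rewrite indicE; case: ifPn.
Qed.

Lemma esum_seq_cst {T : choiceType} (L : seq T) (c : \bar R) : 0 <= c -> uniq L ->
  \esum_(x in [set` L]) c = (size L)%:R%:E * c.
Proof.
move=> c0 uL; transitivity (\esum_(x in [set` L]) (c * 1)).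
  by apply: eq_esum => *; rewrite mule1.
rewrite ge0_esumZl// esum_one muleC; congr (_ * _).
case: pselect => [fL|[]]; last by apply/finite_seqP; exists L.
congr (_%:R%:E); rewrite -[in RHS](undup_id uL) -card_fseq; congr (#|` _|).
apply/fsetP => x; rewrite in_fset_set//.
by apply/idP/imfsetP => [/set_mem xL|[y yL ->]]; [exists x|exact/mem_set].
Qed.

(** Counts become sums of indicators of tail events, so that expectations of
    products of counts reduce to probabilities of intersections. *)
Lemma layer_cake (x : \bar R) : x = +oo \/ (exists k, x = k%:R%:E) ->
  x = \esum_(k in [set: nat]) (\1_[set y : \bar R | (k%:R%:E < y)%E] x)%:E.
Proof.
move=> hx.
have -> : (fun k => (\1_[set y : \bar R | (k%:R%:E < y)%E] x)%:E) =
          (fun k : nat => (\1_[set k : nat | (k%:R%:E < x)%E] k : R)%:E).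
  by apply/funext => k; congr (_%:E); exact: eq_indic.
rewrite esum_indic esum_one; case: hx => [->|[n ->]].
  case: pselect => // fS; exfalso; apply: infinite_nat; apply: sub_finite_set fS.
  by move=> k _ /=; exact: ltry.
have -> : [set k : nat | k%:R%:E < n%:R%:E :> \bar R] = `I_n.
  by apply/seteqP; split => k /=; rewrite lte_fin ltr_nat.
case: pselect => [?|[]]; last exact: finite_II.
by rewrite (@card_fset_set _ `I_n n)// card_eqxx.
Qed.

Lemma esum_indic_nat {T : choiceType} (S : set T) :
  let x := \esum_(i in [set: T]) (\1_S i : R)%:E in
  x = +oo \/ exists k : nat, x = k%:R%:E.
Proof.
by rewrite /= esum_indic esum_one; case: pselect => ?; [right; eexists|left].
Qed.

Lemma prod_indic {T I : Type} (s : seq I) (A : I -> set T) x :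
  \prod_(i <- s) (\1_(A i) x : R)%:E =
  (\1_[set y | all (fun i => y \in A i) s] x : R)%:E.
Proof.
elim: s => [|i s IHs]; first by rewrite big_nil indicE mem_set.
rewrite big_cons {}IHs -EFinM; congr (_%:E).
rewrite !indicE -natrM mulnb; congr (_%:R)%R; congr nat_of_bool.
apply/andP/idP => [[xi /set_mem/= xs]|/set_mem/= /andP[xi xs]].
  by apply/mem_set => /=; rewrite xi.
by split => //; exact/mem_set.
Qed.

Lemma prod_indic_ord {T : Type} n (A : 'I_n -> set T) x :
  \prod_(i < n) (\1_(A i) x : R)%:E = (\1_[set y | forall i, A i y] x : R)%:E.
Proof.
rewrite prod_indic; congr (_%:E); apply: eq_indic => /=; split.
  by move=> /allP xA i; apply/set_mem/xA; rewrite mem_index_enum.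
by move=> xA; apply/allP => i _; apply/mem_set.
Qed.

End counting.

(** * Poisson variables *)

Section poisson_moments.
Context {R : realType} {d} {Omega : measurableType d} (P : probability Omega R).
Local Open Scope ereal_scope.

Lemma expR_series (h : R) : (0 <= h)%R ->
  \sum_(0 <= k <oo) (h ^+ k / k`!%:R)%:E = (expR h)%:E.
Proof.
move=> h0; rewrite expRE -EFin_lim; last first.
  rewrite /pseries/=; under eq_fun do rewrite mulrC.
  exact: is_cvg_series_exp_coeff.
apply/congr_lim/funext => n/=; rewrite /pseries/= /series/= -sumEFin//.
by under eq_bigr do rewrite mulrC.
Qed.

Context (Z : Omega -> \bar R) (h : R).
Hypothesis mZ : measurable_fun setT Z.
Hypothesis natZ : forall w, Z w = +oo \/ exists k : nat, Z w = k%:R%:E.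
Hypothesis h0 : (0 <= h)%R.
Hypothesis lawZ : forall k : nat,
  P [set w | Z w = k%:R%:E] = (expR (- h) * h ^+ k / k`!%:R)%:E.

Let pmf_ge0 k : (0 <= expR (- h) * h ^+ k / k`!%:R)%R.
Proof. by rewrite divr_ge0// mulr_ge0// ?expR_ge0// exprn_ge0. Qed.

Let mA x : measurable [set w | Z w = x].
Proof. by rewrite -[X in measurable X]setTI; exact: (mZ measurableT _ (emeasurable_set1 x)). Qed.

(** The Poisson weights add up to 1 and leave no mass for the value [+oo]. *)
Let Zfin : P [set w | Z w = +oo] = 0.
Proof.
have -> : [set w | Z w = +oo] = ~` \bigcup_(k : nat) [set w | Z w = k%:R%:E].
  apply/seteqP; split => w /=; first by move=> Zoo [k _] /=; rewrite Zoo.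
  by move=> nZ; case: (natZ w) => // -[k kZ]; exfalso; apply: nZ; exists k.
rewrite probability_setC; last by apply: bigcup_measurable => k _; exact: mA.
rewrite measure_bigcup//=; last first.
  by move=> i j _ _ [w [/= -> [/eqP]]]; rewrite eqr_nat => /eqP.
under eq_eseriesl do rewrite in_setT.
under eq_eseriesr do rewrite lawZ -mulrA EFinM.
rewrite nneseriesZl; last by move=> k _; rewrite lee_fin divr_ge0// exprn_ge0.
by rewrite expR_series// -EFinM expRN mulVf ?subee// gt_eqF// expR_gt0.
Qed.

Lemma expectation_poisson : \int[P]_w Z w = h%:E.
Proof.
rewrite (@ge0_negligible_integral _ _ _ _ _ [set w | Z w = +oo])//; last first.
  by move=> w _; case: (natZ w) => [->//|[k ->]]; rewrite lee_fin.
have mfin : measurable (setT `\` [set w | Z w = +oo]).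
  by rewrite setTD; apply: measurableC; exact: mA.
transitivity (\int[P]_(w in setT `\` [set w | Z w = +oo])
    \sum_(0 <= k <oo) (k%:R%:E * (\1_[set w | Z w = k%:R%:E] w)%:E)).
  apply: eq_integral => w /set_mem[_ /= wfin].
  case: (natZ w) => // -[k kZ]; rewrite (@nneseriesD1 _ _ k)//.
  have wk : w \in [set w | Z w = k%:R%:E] by exact/mem_set.
  rewrite eseries0 => [|i _ /= ik]; first by rewrite indicE wk kZ mule1 adde0.
  rewrite indicE memNset ?mule0//= kZ => -[/eqP].
  by rewrite eqr_nat eq_sym (negbTE ik).
rewrite integral_nneseries//; last first.
  move=> k; apply: measurable_funeM; apply: measurable_funTS.
  by apply/measurable_EFinP; exact: measurable_indic.
transitivity (\sum_(0 <= k <oo) (k%:R * (expR (- h) * h ^+ k / k`!%:R))%:E).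
  apply: eq_eseriesr => k _; rewrite ge0_integralZl//; last first.
    by apply/measurable_EFinP; apply: measurable_funTS; exact: measurable_indic.
  rewrite integral_indic// EFinM -lawZ; congr (_ * P _).
  by apply/seteqP; split => w /= => [[]//|->].
rewrite nneseries_recl//; last by move=> k _; rewrite lee_fin mulr_ge0.
rewrite mul0r add0e -nneseries_addn; last by move=> k; rewrite lee_fin mulr_ge0.
transitivity (\sum_(0 <= k <oo) ((h * expR (- h))%:E * (h ^+ k / k`!%:R)%:E)).
  apply: eq_eseriesr => k _; rewrite -EFinM addn1 factS exprS natrM; congr (_%:E).
  have : (k.+1%:R : R) != 0%R by rewrite pnatr_eq0.
  have : (k`!%:R : R) != 0%R by rewrite pnatr_eq0 -lt0n fact_gt0.
  by move: (k.+1%:R : R)%R (k`!%:R : R)%R (expR _) (h ^+ k)%R => a b c e b0 a0; field; rewrite a0 b0.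
rewrite nneseriesZl; last by move=> k _; rewrite lee_fin divr_ge0// exprn_ge0.
by rewrite expR_series// -EFinM -mulrA expRN mulVf ?mulr1// gt_eqF// expR_gt0.
Qed.

(** The probability is 1 - (1 + h) exp (- h), and exp (- h) >= 1 - h. *)
Lemma poisson_ge2 : P [set w | 1 < Z w] <= (h ^+ 2)%:E.
Proof.
have -> : [set w | 1 < Z w] =
    ~` ([set w | Z w = 0] `|` [set w | Z w = 1]).
  apply/seteqP; split => w /=.
    by move=> Z1 [] Zw; move: Z1; rewrite Zw lte_fin ?ltxx// ltr10.
  move=> nZ; case: (natZ w) => [->|[[|[|k]] kZ]]; rewrite ?ltry//.
  - by exfalso; apply: nZ; left.
  - by exfalso; apply: nZ; right.
  - by rewrite kZ lte_fin (ltr_nat _ 1).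
rewrite probability_setC; last by apply: measurableU; exact: mA.
have l0 : P [set w | Z w = 0] = (expR (- h))%:E.
  by rewrite (lawZ 0%N) expr0 mulr1 divr1.
have l1 : P [set w | Z w = 1] = (expR (- h) * h)%:E.
  by rewrite (lawZ 1%N) expr1 divr1.
have -> : P ([set w | Z w = 0] `|` [set w | Z w = 1]) =
          (expR (- h) + expR (- h) * h)%:E.
  rewrite measureU; [|exact: mA|exact: mA|].
    by rewrite EFinD; congr (_ + _); [exact: l0|exact: l1].
  by apply/seteqP; split => // w [/= -> [/eqP]]; rewrite eq_sym oner_eq0.
rewrite -EFinB lee_fin.
have e1 : (1 - h <= expR (- h))%R by exact: expR_ge1Dx.
have h1 : (0 <= 1 + h)%R by rewrite addr_ge0.
have := ler_wpM2r h1 e1.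
set e := expR _; nra.
Qed.

End poisson_moments.

(** * Counts of the points of an enumerated process *)

Section enumerated_points.
Context {R : realType} {d} {X : measurableType d} {d'} {S : measurableType d'}.
Context {N : S -> \bar R} {pt : nat -> S -> X} {W : set X}.
Hypothesis mN : measurable_fun setT N.
Hypothesis mpt : forall n, measurable_fun setT (pt n).
Hypothesis mW : measurable W.

Definition hit (N : S -> \bar R) (pt : nat -> S -> X) (n : nat) (B : set X) :=
  [set w | (n%:R%:E < N w)%E /\ B (pt n w)].

Lemma measurable_hit n B : measurable B -> measurable (hit N pt n B).
Proof.
move=> mB; apply: measurableI.
  by rewrite -[X in measurable X]setTI; exact: emeasurable_fun_o_infty.
by rewrite -[X in measurable X]setTI; exact: mpt.
Qed.

Definition points_at (pt : nat -> S -> X) {r} (nu : r.-tuple nat) (w : S) :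
  r.-tuple X := map_tuple (pt ^~ w) nu.

Definition hits (N : S -> \bar R) (pt : nat -> S -> X) (W : set X) {r}
    (nu : r.-tuple nat) : set S :=
  [set w | forall i, hit N pt (tnth nu i) W w].

Lemma tnth_points_at {r} (nu : r.-tuple nat) w i :
  tnth (points_at pt nu w) i = pt (tnth nu i) w.
Proof. by rewrite tnth_map. Qed.

Lemma measurable_points_at {r} (nu : r.-tuple nat) :
  measurable_fun setT (points_at pt nu).
Proof.
apply/measurable_fun_tnthP => i.
rewrite (_ : _ \o _ = pt (tnth nu i)); first exact: mpt.
by apply/funext => w /=; rewrite tnth_points_at.
Qed.

Lemma measurable_hits {r} (nu : r.-tuple nat) : measurable (hits N pt W nu).
Proof.
rewrite (_ : hits _ _ _ nu = \bigcap_(i in [set: 'I_r]) hit N pt (tnth nu i) W).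
  by apply: fin_bigcap_measurable => // i _; exact: measurable_hit.
by apply/seteqP; split => w h i; [move=> _|]; exact: h.
Qed.

End enumerated_points.

Section poisson_process_points.
Context {R : realType} {d} {X : measurableType d} {d'} {Omega : measurableType d'}.
Context {P : probability Omega R} {mu : set X -> \bar R}.
Context {N : Omega -> \bar R} {pt : nat -> Omega -> X}.
Hypothesis mu_ge0 : forall B, (0 <= mu B)%E.
Hypothesis hPhi : enumerated_poisson_process P mu N pt.
Local Open Scope ereal_scope.

Lemma point_measureE w B : point_measure N pt w B =
  \esum_(n in [set: nat]) (\1_(hit N pt n B) w)%:E.
Proof.
rewrite /point_measure nneseries_esum//= esum_mkcond; apply: eq_esum => n _.
rewrite diracE !indicE; case: ifPn => [/set_mem/= nN|/negP nN].
  congr (_%:R%:E); congr nat_of_bool.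
  by apply/idP/idP => [/set_mem ?|/set_mem[_ ?]]; exact/mem_set.
by rewrite memNset// => -[/= nN' _]; apply: nN; exact/mem_set.
Qed.

Lemma point_measure_nat w B : point_measure N pt w B = +oo \/
  exists k : nat, point_measure N pt w B = k%:R%:E.
Proof.
rewrite point_measureE.
have -> : (fun n => (\1_(hit N pt n B) w)%:E) =
          (fun n => (\1_[set n | hit N pt n B w] n : R)%:E).
  by apply/funext => n; congr (_%:E); exact: eq_indic.
exact: esum_indic_nat.
Qed.

Lemma measurable_point_measure B : measurable B ->
  measurable_fun setT (point_measure N pt ^~ B).
Proof. by have [_ _ _ [+ _ _ _]] := hPhi; exact. Qed.

Lemma expectation_point_measure B : measurable B -> mu B < +oo ->
  \int[P]_w point_measure N pt w B = mu B.
Proof.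
have [_ _ _ [_ law _ _]] := hPhi => mB muB.
rewrite (@expectation_poisson _ _ _ P _ (fine (mu B))).
- by rewrite fineK// ge0_fin_numE.
- exact: measurable_point_measure.
- by move=> w; exact: point_measure_nat.
- exact: fine_ge0.
- by move=> k; rewrite law.
Qed.

Lemma point_measure_ge2 B : measurable B -> mu B < +oo ->
  P [set w | 1 < point_measure N pt w B] <= mu B * mu B.
Proof.
have [_ _ _ [_ law _ _]] := hPhi => mB muB.
have muBE : mu B * mu B = (fine (mu B) ^+ 2)%:E.
  by rewrite expr2 EFinM fineK// ge0_fin_numE.
rewrite muBE; apply: poisson_ge2.
- exact: measurable_point_measure.
- by move=> w; exact: point_measure_nat.
- exact: fine_ge0.
- by move=> k; rewrite law.
Qed.

(** By the layer cake formula the left-hand side is a sum, over tuples of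
    levels, of probabilities of intersections of tail events; independence
    factorises each of them, and the sum is again a product. *)
Lemma expectation_prod_point_measure n (B : 'I_n -> set X) :
  (forall i, measurable (B i)) -> trivIset setT B ->
  (forall i, mu (B i) < +oo) ->
  \int[P]_w \prod_(i < n) point_measure N pt w (B i) = \prod_(i < n) mu (B i).
Proof.
have [_ _ _ [_ _ _ indep]] := hPhi => mB tB muB.
pose A (i : 'I_n) (k : nat) : set Omega :=
  [set w | k%:R%:E < point_measure N pt w (B i)].
have mA i k : measurable (A i k).
  rewrite -[X in measurable X]setTI.
  by apply: emeasurable_fun_o_infty => //; exact: measurable_point_measure.
have cake i w : point_measure N pt w (B i) =
    \esum_(k in [set: nat]) (\1_(A i k) w)%:E.
  rewrite [LHS]layer_cake; last exact: point_measure_nat.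
  by apply: eq_esum => k _; congr (_%:E); exact: eq_indic.
under eq_integral do under eq_bigr do rewrite cake.
under eq_integral do rewrite -esum_tuple_prod//.
rewrite integral_esum//; last 2 first.
- by move=> t w; apply: prode_ge0 => i _; rewrite lee_fin.
- move=> t; under eq_fun do rewrite prod_indic_ord.
  apply/measurable_EFinP; apply: measurable_indic.
  rewrite [X in measurable X](_ : _ = \bigcap_(i in setT) A i (tnth t i)).
    by apply: fin_bigcap_measurable.
  by apply/seteqP; split => w h // i; exact: h.
transitivity (\esum_(t in [set: n.-tuple nat]) \prod_(i < n) P (A i (tnth t i))).
  apply: eq_esum => t _; under eq_integral do rewrite prod_indic_ord.
  have inJ i : i \in [fset i | i in 'I_n]%fset by apply/imfsetP; exists i.
  have JT : [set` [fset i | i in 'I_n]%fset] = [set: 'I_n].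
    by apply/seteqP; split => // i _; exact: inJ.
  have := indep n B mB tB [fset i | i in 'I_n]%fset (fun i => A i (tnth t i)).
  rewrite JT => /(_ (@subsetT _ _)) PE.
  rewrite integral_indic//; last first.
    rewrite [X in measurable X](_ : _ = \bigcap_(i in setT) A i (tnth t i)).
      by apply: fin_bigcap_measurable.
    by apply/seteqP; split => w h // i; exact: h.
  transitivity (P (\bigcap_(i in setT) A i (tnth t i))).
    by congr (P _); apply/seteqP; split => w /= => [[h _] i _|h]; [exact: h|split => // i; exact: h].
  rewrite PE; last first.
    move=> i _; exists [set y : \bar R | (tnth t i)%:R%:E < y]%E.
      by rewrite -[X in measurable X]setTI; exact: emeasurable_fun_o_infty.
    by rewrite setTI.
  apply: perm_big; apply: uniq_perm => //; first exact: index_enum_uniq.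
  by move=> i; rewrite inJ mem_index_enum.
rewrite (@esum_tuple_prod _ _ _ (fun i k => P (A i k)))//.
apply: eq_bigr => i _.
rewrite -expectation_point_measure//.
under eq_integral do rewrite cake.
rewrite integral_esum//; last first.
  by move=> k; apply/measurable_EFinP; exact: measurable_indic.
by apply: eq_esum => k _; rewrite integral_indic// setIT.
Qed.
End poisson_process_points.

(** * Separation of points and null diagonals *)

Section separating_partitions.
Context {R : realType} {d} {X : measurableType d}.

(** The cells are the preimages of the intervals of length 1/k of [0, 1], and
    two points at positive distance in [0, 1] are separated once 1/k is smaller
    than this distance. *)
Lemma separating_partitions : borel_space X R ->
  exists cell : nat -> X -> nat,
    (forall k c, measurable [set x | cell k x = c]) /\
    (forall x y, x <> y -> \forall k \near \oo, cell k x <> cell k y).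
Proof.
move=> [f [finj f01 mf _]].
have f0 x : 0 <= f x by have := f01 (f x) (ex_intro2 _ _ x I erefl); rewrite /= in_itv/= => /andP[].
exists (fun k x => Num.truncn (k%:R * f x)); split.
  move=> k c; rewrite (_ : [set x | _] = f @^-1` [set y | 0 <= y /\ c%:R <= k%:R * y < c.+1%:R]).
    rewrite -[X in measurable X]setTI; apply: mf => //.
    rewrite (_ : [set y | _] = `[0, +oo[ `&` (fun y => k%:R * y) @^-1` `[c%:R, c.+1%:R[); last first.
      by apply/seteqP; split => y /=; rewrite !in_itv/= andbT.
    apply: measurableI => //; rewrite -[X in measurable X]setTI.
    exact: (measurable_funM (measurable_cst _) (@measurable_id _ _ _)).
  apply/seteqP; split => x /=.
    by move=> <-; split => //; rewrite truncn_itv// mulr_ge0.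
  by move=> [_ cx]; apply/eqP; rewrite truncn_eq// mulr_ge0.
move=> x y xy; have fxy : 0 < `|f x - f y|.
  by rewrite normr_gt0 subr_eq0; apply/eqP => /finj.
exists (Num.bound (`|f x - f y|^-1)) => // k /=; rewrite -(ler_nat R) => kb.
have k1 : 1 < k%:R * `|f x - f y|.
  by rewrite -ltr_pdivrMr// div1r (lt_le_trans _ kb)// archi_boundP// invr_ge0.
have k0 : 0 <= k%:R :> R by [].
move: k1; rewrite -[k%:R in X in X -> _](ger0_norm k0) -normrM mulrBr => k1 exy.
have /andP[x1 x2] := truncn_itv (mulr_ge0 k0 (f0 x)).
have /andP[y1 y2] := truncn_itv (mulr_ge0 k0 (f0 y)).
rewrite -exy in y1 y2; rewrite -natr1 in x2 y2.
by move: k1; rewrite ltNge => /negP; apply; rewrite ler_norml; lra.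
Qed.

(** The isomorphism with a set of reals makes equality of points the vanishing
    of a real measurable function. *)
Lemma measurable_eq_points {d'} {Y : measurableType d'} (u v : Y -> X) :
  borel_space X R -> measurable_fun setT u -> measurable_fun setT v ->
  measurable [set y | u y = v y].
Proof.
move=> [f [finj f01 mf _]] mu mv.
rewrite (_ : [set y | _] = (fun y => f (u y) - f (v y)) @^-1` [set 0]).
  rewrite -[X in measurable X]setTI.
  have muv : measurable_fun setT (fun y => f (u y) - f (v y)).
    by apply: measurable_funB; apply: measurableT_comp.
  exact: muv.
apply/seteqP; split => y /=; first by move=> ->; rewrite subrr.
by move/eqP; rewrite subr_eq0 => /eqP/finj.
Qed.

End separating_partitions.

Section power_measure_lemmas.
Context {R : realType} {d} {X : measurableType d}.
Variable lambda : {sigma_finite_measure set X -> \bar R}.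
Local Open Scope ereal_scope.

Definition rect {T : Type} {n} (B : 'I_n -> set T) : set (n.-tuple T) :=
  [set t | forall i, B i (tnth t i)].

Lemma measurable_rect n (B : 'I_n -> set X) :
  (forall i, measurable (B i)) -> measurable (rect B).
Proof.
move=> mB; rewrite (_ : rect B = \bigcap_(i in setT) ((@tnth n X ^~ i) @^-1` B i)).
  apply: fin_bigcap_measurable => // i _; rewrite -[X in measurable X]setTI.
  exact: measurable_tnth.
by apply/seteqP; split => t h; [move=> i _; exact: h|move=> i; exact: h].
Qed.

Lemma power_measureS n (A : set (n.+1.-tuple X)) :
  power_measure lambda n.+1 A =
  (lambda \x power_measure lambda n) (@cons_pair _ X n @^-1` A).
Proof. by []. Qed.

Lemma power_measure_rect n (B : 'I_n -> set X) : (forall i, measurable (B i)) ->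
  power_measure lambda n (rect B) = \prod_(i < n) lambda (B i).
Proof.
elim: n B => [|n IHn] B mB.
  rewrite big_ord0 /= diracE mem_set//.
  by move=> [].
rewrite power_measureS (_ : _ @^-1` _ = B ord0 `*` rect (fun i => B (lift ord0 i))).
  rewrite product_measure1E//; last by apply: measurable_rect.
  by rewrite IHn// big_ord_recl.
apply/seteqP; split => -[x t] /=.
  move=> h; split; first exact: (h ord0).
  by move=> i; have := h (lift ord0 i); rewrite /= tnthS.
move=> [Bx Bt] i; case: (unliftP ord0 i) => [j ->|->//].
by rewrite /= tnthS; exact: Bt.
Qed.

Definition dup {T : eqType} n : set (n.-tuple T) := [set t | ~~ uniq t].

Hypothesis bX : borel_space X R.
Hypothesis diff_lambda : diffuse lambda.

Lemma measurable_dup n : measurable (@dup X n).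
Proof.
rewrite (_ : dup n = \bigcup_(p in [set p : 'I_n * 'I_n | p.1 != p.2])
    [set t | tnth t p.1 = tnth t p.2]).
  apply: fin_bigcup_measurable => // p _.
  apply: (measurable_eq_points (fun t : n.-tuple X => tnth t p.1) (fun t => tnth t p.2) bX);
    exact: measurable_tnth.
apply/seteqP; split => t /=.
  move=> /tuple_uniqP nt; apply: contrapT => h; apply: nt => i j ij.
  by apply: contrapT => /eqP nij; apply: h; exists (i, j).
by move=> [[i j] /= ij tij]; apply/tuple_uniqP => /(_ _ _ tij)/eqP; rewrite (negbTE ij).
Qed.

(** Every section of the graph at a point of [Y] is a singleton; the product
    measure has to be computed by integrating over [Y] last. *)
Lemma diffuse_graph {d'} {Y : measurableType d'}
    (m : {sigma_finite_measure set Y -> \bar R}) (v : Y -> X) :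
  measurable_fun setT v -> (lambda \x m) [set p | p.1 = v p.2] = 0.
Proof.
move=> mv; have mg : measurable [set p : X * Y | p.1 = v p.2].
  apply: (measurable_eq_points (fun p : X * Y => p.1) (fun p => v p.2) bX).
    exact: measurable_fst.
  by apply: measurableT_comp mv _; exact: measurable_snd.
transitivity ((lambda \x^ m) [set p : X * Y | p.1 = v p.2]).
  by apply: product_measure_unique => // A B mA mB; exact: product_measure2E.
rewrite /product_measure2 integral0_eq// => y _ /=.
rewrite (_ : ysection _ _ = [set v y]) ?diff_lambda//.
by apply/seteqP; split => x; rewrite /ysection/= inE.
Qed.

(** If a tuple has a repeated entry, either its head is one of the entries of
    its tail, which is a finite union of graphs, or its tail has one. *)
Lemma power_measure_dup n : power_measure lambda n (@dup X n) = 0.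
Proof.
elim: n => [|n IHn].
  by rewrite (_ : dup 0 = set0) ?measure0//; apply/seteqP; split => // t; rewrite /dup/= tuple0.
rewrite power_measureS; apply/eqP; rewrite -measure_le0.
have mA (i : 'I_n) : measurable [set p : X * n.-tuple X | p.1 = tnth p.2 i].
  apply: (measurable_eq_points (fun p : X * n.-tuple X => p.1) (fun p => tnth p.2 i) bX).
    exact: measurable_fst.
  by apply: measurableT_comp (measurable_tnth i) _; exact: measurable_snd.
have mB : measurable ((setT : set X) `*` @dup X n).
  by apply: measurableX => //; exact: measurable_dup.
apply: (@le_trans _ _ ((lambda \x power_measure lambda n)
   ((\bigcup_(i in [set: 'I_n]) [set p | p.1 = tnth p.2 i]) `|` (setT `*` @dup X n)))).
  apply: le_measure; rewrite ?inE.
  - rewrite -[X in measurable X]setTI; apply: measurable_cons_pair => //.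
    exact: measurable_dup.
  - by apply: measurableU => //; exact: fin_bigcup_measurable.
  - move=> [x t] /=; rewrite /dup /= negb_and negbK => /orP[/tnthP[i xi]|dt].
      by left; exists i.
    by right.
apply: le_trans (measureU2 _ _ _) _ => //; first exact: fin_bigcup_measurable.
rewrite [X in _ + X <= _](_ : _ = 0); last first.
  transitivity (lambda setT * power_measure lambda n (@dup X n)).
    by apply: product_measure1E => //; exact: measurable_dup.
  by rewrite IHn mule0.
rewrite adde0.
apply: le_trans (@content_sub_fsum _ _ _ _ _ setT _
    (fun i : 'I_n => [set p | p.1 = tnth p.2 i]) _ _ _ _) _ => //.
- exact: (@finite_finset 'I_n).
- exact: fin_bigcup_measurable.
- by rewrite fsbig1// => i _; exact: (diffuse_graph _ _ (measurable_tnth i)).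
Qed.

End power_measure_lemmas.

(** * The points of a Poisson process are distinct *)

Section restricted_image.
Context {R : realType} {d d'} {S : measurableType d} {Y : measurableType d'}.
Local Open Scope ereal_scope.

Lemma ge0_integral_mrestr (mu : {measure set S -> \bar R}) (E : set S)
    (mE : measurable E) (f : S -> \bar R) :
  measurable_fun setT f -> (forall x, 0 <= f x) ->
  \int[mrestr mu mE]_x f x = \int[mu]_(x in E) f x.
Proof.
move=> mf f0; have mCE : measurable (~` E) by exact: measurableC.
have restrC : mrestr mu mE (~` E) = 0 by rewrite /mrestr setICl measure0.
apply: (etrans (ge0_negligible_integral mCE measurableT mf (fun x _ => f0 x) restrC)).
rewrite setTD setCK; apply: eq_measure_integral => A mA AE.
by rewrite /= /mrestr setIidl.
Qed.

(** The law of [u] on the event [E], without the factor 1 / mu E, so that [E] may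
    be null. *)
Definition restricted_image (mu : {measure set S -> \bar R}) (E : set S)
    (mE : measurable E) (u : S -> Y) (hu : measurable_fun setT u) :
    {measure set Y -> \bar R} :=
  measure_function_pushforward__canonical__measure_function_Measure
    (mrestr mu mE) hu.

Lemma restricted_imageE (mu : {measure set S -> \bar R}) (E : set S)
    (mE : measurable E) (u : S -> Y) (hu : measurable_fun setT u) A :
  restricted_image mu E mE u hu A = mu (u @^-1` A `&` E).
Proof. by []. Qed.

Lemma ge0_integral_restricted_image (mu : {measure set S -> \bar R}) (E : set S)
    (mE : measurable E) (u : S -> Y) (hu : measurable_fun setT u) f :
  measurable_fun setT f -> (forall y, 0 <= f y) ->
  \int[restricted_image mu E mE u hu]_y f y = \int[mu]_(x in E) f (u x).
Proof.
move=> mf f0; rewrite ge0_integral_pushforward// preimage_setT.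
by apply: (ge0_integral_mrestr mu E mE (f \o u)) => [|x];
   [exact: measurableT_comp mf hu|exact: f0].
Qed.

End restricted_image.

Section distinct_points.
Context {R : realType} {d} {X : measurableType d} {d'} {Omega : measurableType d'}.
Variable lambda : {sigma_finite_measure set X -> \bar R}.
Context {P : probability Omega R} {beta : R}.
Context {N : Omega -> \bar R} {pt : nat -> Omega -> X}.
Hypothesis beta_ge0 : (0 <= beta)%R.
Local Notation mu := (fun B => beta%:E * lambda B)%E.
Hypothesis hPhi : enumerated_poisson_process P mu N pt.
Hypothesis bX : borel_space X R.
Hypothesis diff_lambda : diffuse lambda.
Context {W : set X}.
Hypothesis mW : measurable W.
Hypothesis lambdaW : (lambda W < +oo)%E.
Local Open Scope ereal_scope.

Let mu_ge0 B : 0 <= mu B.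
Proof. by rewrite mule_ge0. Qed.

Lemma lambda_subW_lty B : measurable B -> B `<=` W -> lambda B < +oo.
Proof. by move=> mB BW; apply: le_lt_trans lambdaW; apply: le_measure; rewrite ?inE. Qed.

Lemma lambda_subW_fin B : measurable B -> B `<=` W -> lambda B \is a fin_num.
Proof. by move=> mB BW; rewrite ge0_fin_numE// lambda_subW_lty. Qed.

Lemma mu_subW_lty B : measurable B -> B `<=` W -> mu B < +oo.
Proof. by move=> mB BW; rewrite lte_mul_pinfty// lambda_subW_lty. Qed.

Definition double_point : set Omega :=
  \bigcup_n \bigcup_(m in [set m | n != m])
    (hit N pt n W `&` hit N pt m W `&` [set w | pt n w = pt m w]).

Lemma measurable_double_point : measurable double_point.
Proof.
have [mN _ mpt _] := hPhi.
apply: bigcup_measurable => n _; apply: bigcup_measurable => m _.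
apply: measurableI; last exact: (measurable_eq_points _ _ bX).
by apply: measurableI; exact: measurable_hit.
Qed.

Lemma hit2_point_measure n m w B : n != m ->
  hit N pt n B w -> hit N pt m B w -> 1 < point_measure N pt w B.
Proof.
move=> nm hn hm; rewrite point_measureE.
apply: (@lt_le_trans _ _ 2%:E); first by rewrite lte_fin ltr1n.
apply: esum_ge; exists [set` [fset n; m]%fset].
  by split => //; exact: finite_fset.
rewrite fsbig_finite//= set_fsetK big_fsetU1/= ?inE// big_seq_fset1.
by rewrite !indicE !mem_set.
Qed.

(** The points of [W] that fall into a common cell of a partition number at
    least two in that cell, which has probability at most mu(C)^2; the sum of
    these bounds is the measure of the blocks C x C, which shrink to the
    diagonal, a null set since [lambda] is diffuse. *)
Lemma double_point_null : P double_point = 0.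
Proof.
have [cell [mcell sep]] := @separating_partitions R _ X bX.
pose C k c := W `&` [set x | cell k x = c].
have mC k c : measurable (C k c) by exact: measurableI.
have CW k c : C k c `<=` W by move=> x [].
pose D k := \bigcup_c (C k c `*` C k c).
have mD k : measurable (D k).
  by apply: bigcup_measurable => c _; exact: measurableX.
have bound k : P double_point <= (beta ^+ 2)%:E * (lambda \x lambda) (D k).
  have mE c : measurable [set w | 1 < point_measure N pt w (C k c)].
    rewrite -[X in measurable X]setTI; apply: emeasurable_fun_o_infty => //.
    exact: (measurable_point_measure hPhi).
  apply: (@le_trans _ _ (P (\bigcup_c [set w | 1 < point_measure N pt w (C k c)]))).
    apply: le_measure; rewrite ?inE.
    - exact: measurable_double_point.
    - exact: bigcup_measurable.
    - move=> w [n _ [m /= nm [[[nN nW] [mN mW']] nmE]]].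
      exists (cell k (pt n w)) => //=; apply: (@hit2_point_measure n m) => //.
      by split => //; split => //; rewrite /= nmE.
  apply: (@le_trans _ _ (\sum_(0 <= c <oo) P [set w | 1 < point_measure N pt w (C k c)])).
    by apply: (measure_sigma_subadditive P) => //; exact: bigcup_measurable.
  have -> : (lambda \x lambda) (D k) =
      \sum_(0 <= c <oo) (lambda \x lambda) (C k c `*` C k c).
    rewrite measure_bigcup//=; last first.
    - move=> c c' _ _ [[x y] [[[_ xc] _] [[_ xc'] _]]].
      by rewrite -xc -xc'.
    - by move=> c _; exact: measurableX.
    by apply: eq_eseriesl => c; rewrite in_setT.
  rewrite -nneseriesZl//.
  apply: lee_nneseries => // c _.
  have Cfin := lambda_subW_fin _ (mC k c) (CW k c).
  rewrite product_measure1E// (_ : _ * _ =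
    beta%:E * lambda (C k c) * (beta%:E * lambda (C k c))); last first.
    by rewrite expr2 EFinM !muleA; congr (_ * _); rewrite muleAC.
  exact: (point_measure_ge2 mu_ge0 hPhi _ (mC k c) (mu_subW_lty _ (mC k c) (CW k c))).
have mDk : (lambda \x lambda) (\bigcup_(k in [set k | (0 <= k)%N]) D k) < +oo.
  apply: (@le_lt_trans _ _ ((lambda \x lambda) (W `*` W))).
    apply: le_measure; rewrite ?inE.
    - exact: bigcup_measurable.
    - exact: measurableX.
    - by move=> [x y] [k _ [c _ [[? _] [? _]]]].
  rewrite product_measure1E// lte_mul_pinfty// ge0_fin_numE//.
have cv := lim_sup_set_cvg (lambda \x lambda) D mD mDk.
(* points that share a cell for infinitely many [k] are equal *)
have lim0 : (lambda \x lambda) (lim_sup_set D) = 0.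
  apply/eqP; rewrite -measure_le0.
  rewrite -[leRHS](diffuse_graph lambda bX diff_lambda lambda id (@measurable_id _ X setT)).
  apply: le_measure; rewrite ?inE.
  - apply: bigcap_measurable => // k _; exact: bigcup_measurable.
  - apply: (measurable_eq_points (fun p : X * X => p.1) (fun p => p.2) bX).
      exact: measurable_fst.
    exact: measurable_snd.
  - move=> [x y] /= h; apply: contrapT => /sep[k _ kxy].
    have [j kj [c _ [[_ xc] [_ yc]]]] := h k I.
    by apply: (kxy j kj); rewrite xc yc.
have {}cv : (lambda \x lambda) (\bigcup_(k in [set k | (n <= k)%N]) D k)
    @[n --> \oo] --> (0 : \bar R).
  by move: cv; rewrite [X in _ --> X -> _](_ : _ = 0); [exact|exact: lim0].
apply/eqP; rewrite -measure_le0.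
have : (beta ^+ 2)%:E * (lambda \x lambda)
    (\bigcup_(k in [set k | (n <= k)%N]) D k) @[n --> \oo] --> (beta ^+ 2)%:E * 0.
  exact: cvgeZl.
rewrite mule0 => cv0; apply: (cvge_ge _ cv0).
apply: nearW => n; apply: le_trans (bound n) _.
apply: lee_wpmul2l; first by rewrite lee_fin sqr_ge0.
apply: le_measure; rewrite ?inE//; first exact: bigcup_measurable.
by move=> p Dp; exists n => /=.
Qed.

End distinct_points.

(** * Factorial moment measures *)

Section factorial_moments.
Context {R : realType} {d} {X : measurableType d} {d'} {Omega : measurableType d'}.
Variable lambda : {sigma_finite_measure set X -> \bar R}.
Context {P : probability Omega R} {beta : R}.
Context {N : Omega -> \bar R} {pt : nat -> Omega -> X}.
Hypothesis beta_ge0 : (0 <= beta)%R.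
Local Notation mu := (fun B => beta%:E * lambda B)%E.
Hypothesis hPhi : enumerated_poisson_process P mu N pt.
Hypothesis bX : borel_space X R.
Hypothesis diff_lambda : diffuse lambda.
Context {W : set X}.
Hypothesis mW : measurable W.
Hypothesis lambdaW : (lambda W < +oo)%E.
Local Open Scope ereal_scope.

Let mu_ge0 B : 0 <= mu B.
Proof. by rewrite mule_ge0. Qed.

Let mN : measurable_fun setT N. Proof. by have [] := hPhi. Qed.

Let mpt n : measurable_fun setT (pt n). Proof. by have [_ _ + _] := hPhi; exact. Qed.

Section fixed_size.
Variable r : nat.

(** Integration against this measure is the summand of [nu] in the formula to be
    proved. *)
Let part (nu : r.-tuple nat) : {measure set (r.-tuple X) -> \bar R} :=
  if uniq nu
  then restricted_image P _ (measurable_hits mN mpt mW nu) _ (measurable_points_at mpt nu)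
  else mzero.

Let m_ k : {measure set (r.-tuple X) -> \bar R} :=
  if pickle_inv k is Some nu then part nu else mzero.

Let fact_moment := mseries m_ 0.

Let fact_momentE A : fact_moment A = \esum_(nu in [set: r.-tuple nat]) part nu A.
Proof.
rewrite esum_nneseries//; apply: eq_eseriesr => k _.
by rewrite /m_; case: pickle_inv.
Qed.

Let mWr : measurable (rect (fun=> W) : set (r.-tuple X)).
Proof. by apply: measurable_rect. Qed.

Let beta_r_ge0 : (0 <= beta ^+ r)%R. Proof. exact: exprn_ge0. Qed.

Let power_W := mscale (NngNum beta_r_ge0) (mrestr (power_measure lambda r) mWr).

Let power_WE A : power_W A =
  (beta ^+ r)%:E * power_measure lambda r (A `&` rect (fun=> W)).
Proof. by []. Qed.

Let rects : set (set (r.-tuple X)) :=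
  [set A | exists B : 'I_r -> set X, [/\ forall i, measurable (B i),
     forall i, B i `<=` W, trivIset setT B & A = rect B]].

(** Rectangles with disjoint sides inside [W] miss the tuples that have a
    repeated entry or an entry outside [W]. These tuples are negligible for both
    measures, so all measurable sets of such tuples are added as generators. *)
Let rest : set (r.-tuple X) := @dup X r `|` ~` rect (fun=> W).

Let mrest : measurable rest.
Proof. by apply: measurableU; [exact: (measurable_dup bX)|exact: measurableC]. Qed.

(** On a rectangle with disjoint sides the sum over all index lists factorises
    into the product of the counts of the sides; lists with a repetition do not
    contribute because the sides are disjoint. *)
Let fact_moment_rect A : rects A -> fact_moment A = power_W A.
Proof.
move=> rA; have [B [mB BW tB AE]] := rA.
have muB i : mu (B i) < +oo by exact: (mu_subW_lty lambda beta_ge0 mW lambdaW).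
transitivity (\prod_(i < r) mu (B i)); last first.
  rewrite power_WE AE setIidl; last by move=> t Bt i; exact/BW/Bt.
  rewrite power_measure_rect// big_split/= prodEFin prodr_const card_ord.
  by [].
have mh (t : r.-tuple nat) :
    measurable [set w | forall i, hit N pt (tnth t i) (B i) w].
  rewrite (_ : [set w | _] = \bigcap_(i in [set: 'I_r]) hit N pt (tnth t i) (B i)).
    by apply: fin_bigcap_measurable => // i _; exact: measurable_hit.
  by apply/seteqP; split => w h i; [move=> _|]; exact: h.
rewrite -(expectation_prod_point_measure mu_ge0 hPhi)//.
under eq_integral do under eq_bigr do rewrite point_measureE.
under eq_integral do rewrite -(@esum_tuple_prod _ _ _ (fun i n => (\1_(hit N pt n (B i)) _)%:E))//.
rewrite integral_esum//; last 2 first.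
- by move=> t w; apply: prode_ge0 => i _; rewrite lee_fin.
- move=> t; under eq_fun do rewrite prod_indic_ord.
  by apply/measurable_EFinP; exact: measurable_indic.
rewrite fact_momentE; apply: eq_esum => nu _.
under eq_integral do rewrite prod_indic_ord.
rewrite integral_indic// setIT /part; case: ifPn => [unu|dnu].
  rewrite restricted_imageE; congr (P _); rewrite AE.
  apply/seteqP; split => w /=.
    by move=> [hB hW] i; have [? _] := hW i; split => //; rewrite -tnth_points_at; exact: hB.
  move=> h; split => i; first by rewrite tnth_points_at; have [] := h i.
  by have [hN hB] := h i; split => //; exact: (BW i _ hB).
rewrite (_ : [set _ | _] = set0) ?measure0//.
apply/seteqP; split => // w /= h; move: dnu => /tuple_uniqP; apply => i j ij.
apply: (tB i j) => //; exists (pt (tnth nu i) w); split; first by have [] := h i.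
by have [] := h j; rewrite ij.
Qed.

(** Distinct indices carry distinct points almost surely, and the powers of a
    diffuse measure do not charge repetitions either. *)
Let fact_moment_rest A : measurable A -> A `<=` rest ->
  fact_moment A = power_W A.
Proof.
move=> mA Arest; transitivity (0 : \bar R).
  rewrite fact_momentE esum1// => nu _; rewrite /part; case: ifPn => // unu.
  rewrite restricted_imageE; apply/eqP; rewrite -measure_le0.
  rewrite -[leRHS](double_point_null lambda beta_ge0 hPhi bX diff_lambda mW lambdaW).
  apply: le_measure; rewrite ?inE.
  - apply: measurableI; last exact: measurable_hits.
    by rewrite -[X in measurable X]setTI; exact: measurable_points_at.
  - exact: (measurable_double_point lambda hPhi bX mW).
  move=> w [/Arest[/negP d1 h|h1 h2]]; last first.
    by exfalso; apply: h1 => i; rewrite tnth_points_at; have [] := h2 i.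
  apply: contrapT => nd; apply: d1; apply/tuple_uniqP => i j.
  rewrite !tnth_points_at => ptij; apply: contrapT => /eqP ij; apply: nd.
  exists (tnth nu i) => //; exists (tnth nu j) => /=.
    by apply: contra ij => /eqP /(tuple_uniqP _ unu) ->.
  by split => //; split; exact: h.
rewrite power_WE (_ : power_measure lambda r _ = 0) ?mule0//.
apply/eqP; rewrite -measure_le0 -[leRHS](power_measure_dup lambda bX diff_lambda r).
apply: le_measure; rewrite ?inE.
- exact: measurableI.
- exact: (measurable_dup bX).
- by move=> t [/Arest[//|h1 h2]].
Qed.

Let generators := rects `|` [set A | measurable A /\ A `<=` rest].

Let generators_setI : setI_closed generators.
Proof.
have Irest A B : measurable A -> measurable B -> B `<=` rest -> generators (A `&` B).
  move=> mA mB Br; right; split; first exact: measurableI.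
  exact: subset_trans (@subIsetr _ _ _) Br.
have mrects A : rects A -> measurable A.
  by move=> [B [mB _ _ ->]]; exact: measurable_rect.
move=> A A' [rA|[mA Ar]] [rA'|[mA' Ar']].
- left; have [[B [mB BW tB ->]] [B' [mB' BW' tB' ->]]] := (rA, rA').
  exists (fun i => B i `&` B' i); split.
  + by move=> i; exact: measurableI.
  + by move=> i x [/BW].
  + by move=> i j _ _ [x [[Bi _] [Bj _]]]; apply: (tB i j) => //; exists x.
  + apply/seteqP; split => t; first by move=> [h h'] i; split; [exact: h|exact: h'].
    by move=> h; split => i; have [] := h i.
- by apply: Irest => //; exact: mrects.
- by rewrite setIC; apply: Irest => //; exact: mrects.
- exact: Irest.
Qed.

(** The entries of a tuple of distinct points of [W] lie in distinct cells of a
    fine enough partition, so the countably many rectangles with distinct cells as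
    sides, together with [rest], cover everything. *)
Let cover : exists c : nat -> set (r.-tuple X),
  (forall k, generators (c k)) /\ \bigcup_k c k = setT.
Proof.
have [cell [mcell sep]] := @separating_partitions R _ X bX.
pose C k j := W `&` [set x | cell k x = j].
pose c (o : option (nat * r.-tuple nat)) : set (r.-tuple X) :=
  if o is Some p then
    if uniq p.2 then rect (fun i => C p.1 (tnth p.2 i)) else set0
  else rest.
have gc o : generators (c o).
  case: o => [[k t]|] /=; last by right; split.
  case: ifPn => [ut|_]; last by right; split.
  left; exists (fun i => C k (tnth t i)); split => //.
  - by move=> i; exact: measurableI.
  - by move=> i x [].
  - move=> i j _ _ [x [[_ /= xi] [_ /= xj]]].
    by apply: (tuple_uniqP _ ut); rewrite -xi -xj.
exists (fun k => oapp c set0 (pickle_inv k)); split.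
  by move=> k; case: pickle_inv => [p|] /=; [exact: gc|right; split].
apply/seteqP; split => // t _.
have [rt|nrt] := pselect (rest t).
  by exists (choice.pickle (None : option (nat * r.-tuple nat))) => //=; rewrite pickleK_inv.
have [ut Wt] : uniq t /\ forall i, W (tnth t i).
  move/not_orP : nrt => [/negP]; rewrite negbK => ut /contrapT Wt.
  by split => // i; exact: Wt.
have : \forall k \near \oo, forall p : 'I_r * 'I_r, p.1 != p.2 ->
    cell k (tnth t p.1) <> cell k (tnth t p.2).
  apply: filter_forall => -[i j] /=; have [->|ij] := eqVneq i j.
    exact: nearW.
  have /sep : tnth t i <> tnth t j.
    by move/(tuple_uniqP _ ut) => /eqP; rewrite (negbTE ij).
  by apply: filterS => k.
case=> k _ /(_ k (leqnn k)) h.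
exists (choice.pickle (Some (k, [tuple cell k (tnth t i) | i < r]))); first by [].
rewrite pickleK_inv /= ifT; last first.
  rewrite map_inj_uniq ?enum_uniq// => i j eij; apply: contrapT => /eqP ij.
  exact: (h (i, j) ij).
by move=> i /=; rewrite tnth_mktuple; split.
Qed.

(** A coordinate cylinder is the union of its traces on the members of the
    countable cover, each of which is a generator. *)
Let generators_generate :
  (measurable : set (set (r.-tuple X))) = <<s generators >>.
Proof.
have mrects A : rects A -> measurable A.
  by move=> [B [mB _ _ ->]]; exact: measurable_rect.
apply/seteqP; split; last first.
  apply: smallest_sub; first exact: sigma_algebra_measurable.
  by move=> A [/mrects|[]].
have [c [gc cT]] := cover.
apply: smallest_sub; first exact: smallest_sigma_algebra.
move=> A; rewrite -bigcup_seq => -[i _ [B mB <-]]; rewrite setTI.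
pose A_ := (fun x : r.-tuple X => tnth x i) @^-1` B.
rewrite -/A_ -(setIT A_) -cT setI_bigcupr.
apply: sigma_algebra_bigcup => k; apply: sub_sigma_algebra.
have mA_ : measurable A_ by rewrite -[X in measurable X]setTI; exact: measurable_tnth.
case: (gc k) => [[B' [mB' BW' tB' ->]]|[mc cr]]; last first.
  right; split; first exact: measurableI.
  exact: subset_trans (@subIsetr _ _ _) cr.
left; exists (fun j => if j == i then B' j `&` B else B' j); split.
- by move=> j; case: ifP => // _; exact: measurableI.
- by move=> j; case: ifP => // _ x [/BW'].
- move=> j k' _ _ [x [Bj Bk]]; apply: (tB' j k') => //; exists x; split.
    by case: ifP Bj => // _ [].
  by case: ifP Bk => // _ [].
- apply/seteqP; split => t.
    by move=> [tB tB''] j; case: ifP => [/eqP ->|_]; [split; [exact: tB''|exact: tB]|exact: tB''].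
  move=> h; split; first by have := h i; rewrite eqxx => -[].
  by move=> j; have := h j; case: ifP => // _ [].
Qed.

Let fact_moment_power A : measurable A -> fact_moment A = power_W A.
Proof.
have [c [gc cT]] := cover.
apply: (measure_unique generators c generators_generate generators_setI gc cT).
  by move=> B [/fact_moment_rect//|[mB Br]]; exact: fact_moment_rest.
move=> k; suff : fact_moment (c k) < +oo by [].
have -> : fact_moment (c k) = power_W (c k).
  by case: (gc k) => [/fact_moment_rect//|[mB Br]]; exact: fact_moment_rest.
rewrite power_WE lte_mul_pinfty ?lee_fin//.
have mck : measurable (c k) by rewrite generators_generate; exact: sub_sigma_algebra.
apply: (@le_lt_trans _ _ (power_measure lambda r (rect (fun=> W)))).
  by apply: le_measure; rewrite ?inE//; exact: measurableI.
rewrite power_measure_rect// -[lambda W]fineK ?prodEFin ?ltry//.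
by rewrite ge0_fin_numE.
Qed.

(** This is the Mecke formula for functions of the points only: the factorial
    moment measures of a Poisson process are the powers of its intensity. It
    suffices to compare the two measures on the generators. *)
Lemma factorial_moment (g : r.-tuple X -> \bar R) :
  measurable_fun setT g -> (forall t, 0 <= g t) ->
  \esum_(nu in [set: r.-tuple nat])
    (if uniq nu then \int[P]_(w in hits N pt W nu) g (points_at pt nu w) else 0) =
  (beta ^+ r)%:E * \int[power_measure lambda r]_(x in rect (fun=> W)) g x.
Proof.
move=> mg g0; transitivity (\int[fact_moment]_x g x).
  rewrite ge0_integral_measure_series// esum_nneseries; last first.
    by move=> nu; case: ifP => // _; exact: integral_ge0.
  apply: eq_eseriesr => k _; rewrite /m_; case: pickle_inv => [nu|] /=.
    rewrite /part; case: ifPn => _; last by rewrite integral_measure_zero.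
    by rewrite ge0_integral_restricted_image.
  by rewrite integral_measure_zero.
rewrite (eq_measure_integral power_W) => [|A mA _]; last exact: fact_moment_power.
rewrite ge0_integral_mscale//= ge0_integral_mrestr//.
Qed.

End fixed_size.
End factorial_moments.

(** * Independent uniform marks *)

Section uniform_marks_integration.
Context {R : realType} {d'} {Omega : measurableType d'} (P : probability Omega R).
Local Open Scope ereal_scope.
Local Notation unif := (uniform_prob (@ltr01 R)).

Lemma uniform_prob_le (c : R) : (0 <= c <= 1)%R ->
  unif [set u | (u <= c)%R] = c%:E.
Proof.
move=> /andP[c0 c1]; have mc : measurable [set u : R | (u <= c)%R].
  by rewrite -set_itvNyc.
have := integral_uniform (@ltr01 R)
  (f := fun u => (\1_[set u : R | (u <= c)%R] u)%:E).
rewrite integral_indic// setIT => ->; last 2 first.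
- by apply/measurable_EFinP; exact: measurable_indic.
- by move=> u; rewrite lee_fin.
rewrite integral_indic// subr0 invr1 mul1e.
rewrite (_ : _ `&` _ = `[0%R, c]%classic); last first.
  apply/seteqP; split => u /=; rewrite !in_itv/=; first by move=> [-> /andP[-> _]].
  by move=> /andP[-> uc]; rewrite uc (le_trans uc).
transitivity (lebesgue_measure ([set` `[0%R, c]] : set R)); first by [].
rewrite lebesgue_measure_itv/= lte_fin; case: ltgtP c0 => // [_ _|<- _].
  by rewrite sube0.
by [].
Qed.

Lemma eq_finite_measure_prod {d1 d2} {T1 : measurableType d1}
    {T2 : measurableType d2} (m1 m2 : {measure set (T1 * T2) -> \bar R}) :
  m1 setT < +oo ->
  (forall A B, measurable A -> measurable B -> m1 (A `*` B) = m2 (A `*` B)) ->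
  forall C, measurable C -> m1 C = m2 C.
Proof.
move=> m1oo m12; apply: (measure_unique
  [set A `*` B | A in measurable & B in measurable] (fun=> setT)).
- exact: measurable_prod_measurableType.
- move=> _ _ [A mA [B mB <-]] [A' mA' [B' mB' <-]]; rewrite -setXI.
  by exists (A `&` A'); [exact: measurableI|exists (B `&` B') => //; exact: measurableI].
- by move=> _; exists setT => //; exists setT => //; rewrite setXTT.
- by rewrite bigcup_const//; exists 0%N.
- by move=> _ [A mA [B mB <-]]; exact: m12.
- by [].
Qed.

Context {I : eqType} (U : I -> Omega -> R).

Definition below {T : Type} (h : I -> T -> R) (Y : Omega -> T) (s : seq I) :=
  [set w | forall i, i \in s -> (U i w <= h i (Y w))%R].

Definition marks_in (V : I -> set R) (s : seq I) :=
  [set w | forall i, i \in s -> V i (U i w)].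

(** Conditional independence given [E], multiplied by the probability of [E] so
    that [E] may be null. *)
Definition independent_marks {d} {T : measurableType d} (E : set Omega)
    (Y : Omega -> T) (s : seq I) :=
  forall (B : set T) (V : I -> set R), measurable B ->
    (forall i, measurable (V i)) ->
    P (E `&` Y @^-1` B `&` marks_in V s) =
    P (E `&` Y @^-1` B) * \prod_(i <- s) unif (V i).

Lemma measurable_marks_in (V : I -> set R) (s : seq I) :
  (forall i, i \in s -> measurable_fun setT (U i)) ->
  (forall i, measurable (V i)) -> measurable (marks_in V s).
Proof.
move=> mU mV; rewrite (_ : marks_in V s = \bigcap_(i in [set` s]) (U i @^-1` V i)).
  apply: fin_bigcap_measurable => [|i si]; first by apply/finite_seqP; exists s.
  by rewrite -[X in measurable X]setTI; exact: mU.
by apply/seteqP; split => w h i; exact: h.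
Qed.

Lemma marks_in_cons V i s : marks_in V (i :: s) = U i @^-1` V i `&` marks_in V s.
Proof.
apply/seteqP; split => w.
  by move=> h; split => [|j js]; apply: h; rewrite inE ?eqxx// js orbT.
by move=> [Vi h] j; rewrite inE => /predU1P[->//|]; exact: h.
Qed.

Lemma independent_marks_head {d} {T : measurableType d} (E : set Omega)
    (Y : Omega -> T) i s : uniq (i :: s) ->
  independent_marks E Y (i :: s) -> independent_marks E Y [:: i].
Proof.
move=> /andP[/negP si _] ind B V mB mV.
(* the other marks are left free *)
pose V' j := if j == i then V i else setT.
have mV' j : measurable (V' j) by rewrite /V'; case: ifP.
have -> : marks_in V [:: i] = marks_in V' (i :: s).
  apply/seteqP; split => w h j.
    by rewrite /V'; case: eqVneq => // -> _; exact: h (mem_head _ _).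
  rewrite inE => /eqP ->; have := h i (mem_head _ _).
  by rewrite /V' eqxx.
rewrite ind// big_seq1 big_cons {1}/V' eqxx.
rewrite [X in _ * (_ * X)]big1_seq ?mule1// => j js.
rewrite /V'; case: eqVneq => [ji|_]; last exact: probability_setT.
by exfalso; apply: si; rewrite -ji.
Qed.

(** Finite measures that agree on rectangles are equal, and independence is
    agreement on rectangles. *)
Lemma mark_joint_law {d} {T : measurableType d} (E : set Omega)
    (Y : Omega -> T) i :
  measurable E -> measurable_fun setT Y -> measurable_fun setT (U i) ->
  independent_marks E Y [:: i] ->
  forall C : set (T * R), measurable C ->
  P (E `&` [set w | C (Y w, U i w)]) =
  (P \x unif) [set p | E p.1 /\ C (Y p.1, p.2)].
Proof.
move=> mE mY mUi ind C mC.
have mYU : measurable_fun setT (fun w => (Y w, U i w)) by exact: measurable_fun_pair.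
have mET : measurable (E `*` (setT : set R)) by exact: measurableX.
have mYid : measurable_fun setT (fun p : Omega * R => (Y p.1, p.2)).
  by apply: measurable_fun_pair; [exact: measurableT_comp mY measurable_fst|exact: measurable_snd].
have m1oo : restricted_image P E mE _ mYU setT < +oo.
  rewrite restricted_imageE (le_lt_trans (probability_le1 _ _)) ?ltry//.
  by rewrite preimage_setT setTI.
have := eq_finite_measure_prod (restricted_image P E mE _ mYU)
  (restricted_image (P \x unif) _ mET _ mYid) m1oo _ C mC.
rewrite !restricted_imageE setIC => ->.
  by congr ((P \x unif)%E _); apply/seteqP; split => -[w u] /=; [move=> [? []]|move=> []].
move=> A B mA mB; rewrite !restricted_imageE.
have -> : (fun p : Omega * R => (Y p.1, p.2)) @^-1` (A `*` B) `&` (E `*` setT) =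
    (E `&` Y @^-1` A) `*` B.
  by apply/seteqP; split => -[w u] /=; [move=> [[? ?] []]|move=> [[]]].
have mEA : measurable (E `&` Y @^-1` A).
  by apply: measurableI => //; rewrite -[X in measurable X]setTI; exact: mY.
transitivity (P (E `&` Y @^-1` A) * unif B); last exact/esym/product_measure1E.
have := ind A (fun=> B) mA (fun=> mB); rewrite big_seq1 => <-.
congr (P _); apply/seteqP; split => w /=.
  by move=> [[Aw Bw] Ew]; split => // j; rewrite inE => /eqP ->.
by move=> [[Ew Aw] h]; split => //; split => //; exact: h (mem_head _ _).
Qed.

(** A mark may be moved from the independent family to the conditioning
    variable, which lets the marks be integrated out one at a time. *)
Lemma independent_marks_cons {d} {T : measurableType d} (E : set Omega)
    (Y : Omega -> T) i s :
  measurable E -> measurable_fun setT Y ->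
  (forall j, j \in i :: s -> measurable_fun setT (U j)) -> uniq (i :: s) ->
  independent_marks E Y (i :: s) ->
  independent_marks E (fun w => (Y w, U i w)) s.
Proof.
move=> mE mY mU us ind C V mC mV.
have mUi : measurable_fun setT (U i) by apply: mU; rewrite inE eqxx.
have mU' j : j \in s -> measurable_fun setT (U j).
  by move=> js; apply: mU; rewrite inE js orbT.
have mYU : measurable_fun setT (fun w => (Y w, U i w)) by exact: measurable_fun_pair.
have mEM : measurable (E `&` marks_in V s).
  by apply: measurableI => //; exact: measurable_marks_in.
pose c : R := (\prod_(j <- s) fine (unif (V j)))%R.
have c0 : (0 <= c)%R by apply: prodr_ge0 => j _; exact: fine_ge0.
have cE : \prod_(j <- s) unif (V j) = c%:E.
  rewrite -prodEFin; apply: eq_bigr => j _; rewrite fineK//.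
  exact: (fin_num_measure unif _ (mV j)).
have m1oo : restricted_image P _ mEM _ mYU setT < +oo.
  rewrite restricted_imageE (le_lt_trans (probability_le1 _ _)) ?ltry//.
  by rewrite preimage_setT setTI.
have main : P ((fun w => (Y w, U i w)) @^-1` C `&` (E `&` marks_in V s)) =
    c%:E * P ((fun w => (Y w, U i w)) @^-1` C `&` E); last first.
  rewrite cE muleC [E `&` _ in RHS]setIC -main.
  by congr (P _); rewrite setIA [_ `&` E]setIC.
apply: (eq_finite_measure_prod (restricted_image P _ mEM _ mYU)
  (mscale (NngNum c0) (restricted_image P _ mE _ mYU)) m1oo _ C mC).
move=> A B mA mB; rewrite /mscale/=.
rewrite -[LHS]/(P ((fun w => (Y w, U i w)) @^-1` (A `*` B) `&` (E `&` marks_in V s))).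
rewrite -[X in _ = _ * X]/(P ((fun w => (Y w, U i w)) @^-1` (A `*` B) `&` E)).
have indi := independent_marks_head E Y i s us ind.
have := indi A (fun=> B) mA (fun=> mB); rewrite big_seq1.
rewrite (_ : E `&` _ `&` _ =
    (fun w => (Y w, U i w)) @^-1` (A `*` B) `&` E); last first.
  apply/seteqP; split => w /=.
    by move=> [[Ew Aw] h]; split => //; split => //; exact: h (mem_head _ _).
  by move=> [[Aw Bw] Ew]; split => // j; rewrite inE => /eqP ->.
move=> ->.
pose V' j := if j == i then B else V j.
have mV' j : measurable (V' j) by rewrite /V'; case: ifP.
have V'i : V' i = B by rewrite /V' eqxx.
have := ind A V' mA mV'; rewrite marks_in_cons big_cons V'i.
have iV' j : j \in s -> V' j = V j.
  rewrite /V'; case: eqVneq => // -> js.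
  by move: us; rewrite /= js.
have -> : marks_in V' s = marks_in V s.
  by apply/seteqP; split => w h j js; [rewrite -iV'//|rewrite iV'//]; exact: h.
rewrite (eq_big_seq (fun j => unif (V j))) => [|j js]; last by rewrite iV'.
rewrite cE => e; rewrite muleC -muleA -e; congr (P _).
by apply/seteqP; split => w /=; [move=> [[? ?] []]|move=> [[] ? ? []]].
Qed.

(** By Fubini's theorem, integrating out the mark [U i] replaces its event by the
    probability [h i (Y w)] that a uniform variable is below this threshold. *)
Lemma probability_below {d} {T : measurableType d} (E : set Omega)
    (Y : Omega -> T) (s : seq I) (h : I -> T -> R) (B : set T) :
  measurable E -> measurable_fun setT Y -> uniq s ->
  (forall i, i \in s -> measurable_fun setT (U i)) ->
  (forall i, i \in s -> measurable_fun setT (h i)) ->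
  (forall i t, i \in s -> (0 <= h i t <= 1)%R) ->
  independent_marks E Y s -> measurable B ->
  P (E `&` Y @^-1` B `&` below h Y s) =
  \int[P]_(w in E `&` Y @^-1` B) (\prod_(i <- s) h i (Y w))%:E.
Proof.
move=> mE mY us mU mh h01 ind mB.
have mEB (d0 : measure_display) (T' : measurableType d0) (Y' : Omega -> T') B' :
    measurable_fun setT Y' -> measurable B' -> measurable (E `&` Y' @^-1` B').
  by move=> mY' mB'; apply: measurableI => //; rewrite -[X in measurable X]setTI; exact: mY'.
elim: s d T Y h B mY us mU mh h01 ind mB => [|i s IHs] d T Y h B mY us mU mh h01 ind mB.
  rewrite (_ : below _ _ _ = setT) ?setIT; last by apply/seteqP; split.
  under eq_integral do rewrite big_nil.
  by rewrite integral_cst ?mul1e//; exact: mEB.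
have mUi : measurable_fun setT (U i) by apply: mU; rewrite inE eqxx.
have mhi : measurable_fun setT (h i) by apply: mh; rewrite inE eqxx.
have hi01 t : (0 <= h i t <= 1)%R by apply: h01; rewrite inE eqxx.
have mU' j : j \in s -> measurable_fun setT (U j).
  by move=> js; apply: mU; rewrite inE js orbT.
have mh' j : j \in s -> measurable_fun setT (h j).
  by move=> js; apply: mh; rewrite inE js orbT.
have h01' j t : j \in s -> (0 <= h j t <= 1)%R.
  by move=> js; apply: h01; rewrite inE js orbT.
have us' : uniq s by move: us => /andP[].
have mY' : measurable_fun setT (fun w => (Y w, U i w)) by exact: measurable_fun_pair.
(* the first mark becomes a coordinate of the conditioning variable *)
pose C := [set p : T * R | B p.1 /\ (p.2 <= h i p.1)%R].
have mC : measurable C.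
  apply: measurableI.
    by rewrite -[X in measurable X]setTI; exact: measurable_fst.
  rewrite -[X in measurable X]setTI; apply: measurable_fun_le => //.
  exact: measurableT_comp mhi measurable_fst.
have -> : E `&` Y @^-1` B `&` below h Y (i :: s) =
    E `&` (fun w => (Y w, U i w)) @^-1` C `&`
    below (fun j (p : T * R) => h j p.1) (fun w => (Y w, U i w)) s.
  apply/seteqP; split => w /=.
    move=> [[Ew Bw] b]; split; first by split => //; split => //=; exact: b (mem_head _ _).
    by move=> j js; apply: b; rewrite inE js orbT.
  move=> [[Ew [/= Bw Uw]] b]; split => // j; rewrite inE => /predU1P[->//|].
  exact: b.
rewrite IHs//; last 3 first.
- by move=> j js; exact: measurableT_comp (mh' j js) measurable_fst.
- by move=> j t; exact: h01'.
- exact: independent_marks_cons.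
pose k t : \bar R := (\prod_(j <- s) h j t)%:E.
have k0 t : 0 <= k t.
  rewrite lee_fin big_seq; apply: prodr_ge0 => j js.
  by have /andP[] := h01' j t js.
have mk : measurable_fun setT k by apply/measurable_EFinP; exact: measurable_prod.
rewrite -/k.
have mEC := mEB _ _ _ _ mY' mC.
transitivity (\int[restricted_image P _ mEC _ mY]_t k t).
  by rewrite ge0_integral_restricted_image.
pose D := [set p : Omega * R | E p.1 /\ C (Y p.1, p.2)].
have mYid : measurable_fun setT (fun p : Omega * R => (Y p.1, p.2)).
  by apply: measurable_fun_pair; [exact: measurableT_comp mY measurable_fst|exact: measurable_snd].
have mD : measurable D.
  by apply: measurableI; rewrite -[X in measurable X]setTI;
    [exact: measurable_fst|exact: mYid].
have mY1 : measurable_fun setT (Y \o (@fst Omega R)).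
  exact: measurableT_comp mY measurable_fst.
rewrite (eq_measure_integral (restricted_image (P \x unif) _ mD _ mY1)); last first.
  move=> A mA _; rewrite !restricted_imageE.
  have mCA : measurable (C `&` (A `*` setT)) by apply: measurableI => //; exact: measurableX.
  have := mark_joint_law E Y i mE mY mUi (independent_marks_head E Y i s us ind) _ mCA.
  rewrite (_ : E `&` _ = Y @^-1` A `&` (E `&` (fun w => (Y w, U i w)) @^-1` C)); last first.
    by apply/seteqP; split => w /=; [move=> [? [? []]]|move=> [? [? ?]]; split].
  move=> e; apply: (etrans e); congr ((P \x unif)%E _).
  by apply/seteqP; split => -[w u] /=; [move=> [? [? []]]|move=> [? [? ?]]; split].
rewrite ge0_integral_restricted_image//.
rewrite integral_mkcond fubini_tonelli1//; last 2 first.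
- by apply/(measurable_restrictT _ mD); apply: measurable_funTS; exact: measurableT_comp mk mY1.
- by move=> p; rewrite patchE; case: ifP => // _; exact: k0.
rewrite [RHS]integral_mkcond; apply: eq_integral => w _.
rewrite /fubini_F patchE; case: ifPn => [/set_mem[Ew Bw]|nEB].
  rewrite big_cons EFinM -/(k (Y w)) muleC -(uniform_prob_le (h i (Y w)))//.
  rewrite -[X in unif X]setIT -integral_indic//; last by rewrite -set_itvNyc.
  rewrite -ge0_integralZl//; last first.
    by apply/measurable_EFinP; apply: measurable_indic; rewrite -set_itvNyc.
  apply: eq_integral => u _; rewrite patchE indicE.
  have [uh|uh] := boolP (u <= h i (Y w))%R.
    by rewrite !mem_set ?mule1.
  rewrite !memNset ?mule0//; first exact/negP.
  by move=> [_ [_ /=]]; exact/negP.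
rewrite integral0_eq// => u _; rewrite patchE memNset// => -[/= Ew [/= Bw _]].
by move/negP : nEB; apply; exact/mem_set.
Qed.

End uniform_marks_integration.

Section marks_of_points.
Context {R : realType} {d} {X : measurableType d} {d'} {Omega : measurableType d'}.
Context {P : probability Omega R} {alpha : nat}.
Context {N : Omega -> \bar R} {pt : nat -> Omega -> X}.
Context {U : {fset nat} -> Omega -> R} {W : set X}.
Hypothesis hU : uniform_marks P alpha N pt U.
Hypothesis mW : measurable W.
Local Open Scope ereal_scope.

Let G : set (set Omega) := g_sigma_algebra_preimage N
      `|` \bigcup_n g_sigma_algebra_preimage (pt n).

Let mN : measurable_fun [set: g_sigma_algebraType G] N.
Proof. by move=> _ Y mY; apply: sub_sigma_algebra; left; exists Y. Qed.

Let mpt n : measurable_fun [set: g_sigma_algebraType G] (pt n).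
Proof. by move=> _ Y mY; apply: sub_sigma_algebra; right; exists n => //; exists Y. Qed.

(** Events about the points are measurable for any sigma-algebra that makes the
    enumeration measurable, in particular for the smallest one. *)
Lemma sigma_points_hits {r} (nu : r.-tuple nat) (B : set (r.-tuple X)) :
  measurable B -> sigma_points N pt (hits N pt W nu `&` points_at pt nu @^-1` B).
Proof.
move=> mB; have mh := @measurable_hits _ _ _ _ (g_sigma_algebraType G) _ _ _ mN mpt mW r nu.
have mp := @measurable_points_at _ _ _ (g_sigma_algebraType G) _ mpt r nu measurableT _ mB.
rewrite setTI in mp.
exact: (measurableI _ _ mh mp).
Qed.

Lemma independent_marks_points {r} (nu : r.-tuple nat) (s : seq {fset nat}) :
  uniq s -> (forall K, K \in s -> (2 <= #|` K| <= alpha.+1)%N) ->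
  independent_marks P U (hits N pt W nu) (points_at pt nu) s.
Proof.
move=> us cs B V mB mV; have [_ lawU ind] := hU.
pose E (k : option {fset nat}) : set Omega :=
  if k is Some K then U K @^-1` V K
  else hits N pt W nu `&` points_at pt nu @^-1` B.
pose J : {fset option {fset nat}} := [fset k in None :: map Some s]%fset.
have inJ k : (k \in J) = (k \in None :: map Some s) by rewrite !inE.
have := ind J E; rewrite (_ : \bigcap_(i in [set` J]) E i =
    hits N pt W nu `&` points_at pt nu @^-1` B `&` marks_in U V s); last first.
  apply/seteqP; split => w h.
    split; first by apply: (h None); rewrite /= inJ inE.
    by move=> K Ks; apply: (h (Some K)); rewrite /= inJ inE map_f.
  case=> [K|] /=; rewrite inJ inE; last by move=> _; have [] := h.
  by rewrite orFb mem_map; [move=> Ks; exact: h.2|move=> ? ? []].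
move=> ->.
- rewrite (perm_big (None :: map Some s)); last first.
    apply: uniq_perm => //=; first exact: fset_uniq.
    rewrite map_inj_uniq ?us ?andbT; last by move=> ? ? [].
    by apply/mapP => -[].
  rewrite big_cons big_map; congr (_ * _).
  by apply: eq_big_seq => K Ks; exact: lawU (cs K Ks) (mV K).
- move=> [K|] /=; rewrite inJ inE; last by left.
  rewrite orFb mem_map; last by move=> ? ? [].
  by move=> Ks; right; exists K => //; exact: cs.
- move=> [K|] _ /=; last exact: sigma_points_hits.
  by exists (V K) => //; rewrite setTI.
Qed.

End marks_of_points.

(** * Pairs of overlapping finite sets *)

Section overlapping_pairs.
Context {R : realType} {T : choiceType}.
Variables (m l r : nat).
Hypothesis mr : (m <= r)%N.
Hypothesis lr : (l <= r)%N.
Hypothesis rml : (r <= m + l)%N.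
Local Open Scope ereal_scope.
Local Open Scope fset_scope.

Let p := (m + l - r)%N.

(** The arrangement of the vertices is that of the two simplices in [kappa]. *)
Definition fst_face (s : seq T) : {fset T} := [fset x in take m s].
Definition snd_face (s : seq T) : {fset T} := [fset x in take (m + l - r) s ++ drop m s].

Lemma mem_fst_face s : fst_face s =i take m s.
Proof. by move=> x; apply/imfsetP/idP => [[y ys ->]//|xs]; exists x. Qed.

Lemma mem_snd_face s : snd_face s =i take (m + l - r) s ++ drop m s.
Proof. by move=> x; apply/imfsetP/idP => [[y ys ->]//|xs]; exists x. Qed.

Definition overlapping : set ({fset T} * {fset T}) :=
  [set k | [/\ #|` k.1| = m, #|` k.2| = l & #|` k.1 `|` k.2| = r]].

Definition orderings (k : {fset T} * {fset T}) : seq (seq T) :=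
  [seq a ++ bc | a <- permutations (k.1 `&` k.2),
     bc <- [seq b ++ c | b <- permutations (k.1 `\` k.2),
                         c <- permutations (k.2 `\` k.1)]].

Let overlapping_cards k : overlapping k ->
  [/\ #|` k.1 `&` k.2| = p, #|` k.1 `\` k.2| = (r - l)%N & #|` k.2 `\` k.1| = (r - m)%N].
Proof.
case: k => A B [/= cA cB cAB].
have := cardfsUI A B; have := cardfsID B A; have := cardfsID A B.
rewrite fsetIC cA cB cAB /p => e1 e2 e3.
by split; lia.
Qed.

Lemma uniq_orderings k : uniq (orderings k).
Proof.
apply: allpairs_uniq; first exact: permutations_uniq.
  apply: allpairs_uniq; [exact: permutations_uniq|exact: permutations_uniq|].
  move=> [b c] [b' c'] /allpairsP[[? ?] /= [pb pc [-> ->]]].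
  move=> /allpairsP[[? ?] /= [pb' pc' [-> ->]]] /= /eqP.
  rewrite eqseq_cat; first by case/andP => /eqP -> /eqP ->.
  by move: pb pb'; rewrite !mem_permutations => /perm_size -> /perm_size ->.
move=> [b c] [b' c'] /allpairsP[[? ?] /= [pb pc [-> ->]]].
move=> /allpairsP[[? ?] /= [pb' pc' [-> ->]]] /= /eqP.
rewrite eqseq_cat; first by case/andP => /eqP -> /eqP ->.
by move: pb pb'; rewrite !mem_permutations => /perm_size -> /perm_size ->.
Qed.

Lemma size_orderings k : overlapping k ->
  size (orderings k) = ((r - m)`! * (r - l)`! * (m + l - r)`!)%N.
Proof.
move=> /overlapping_cards[cI c1 c2].
rewrite !size_allpairs !size_permutations ?fset_uniq// cI c1 c2 /p.
by rewrite mulnC [in LHS]mulnC mulnC [((r - l)`! * _)%N]mulnC.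
Qed.

Lemma mem_orderings k s : overlapping k -> s \in orderings k ->
  [/\ uniq s, size s = r, fst_face s = k.1 & snd_face s = k.2].
Proof.
move=> ok; have [cI c1 c2] := overlapping_cards k ok.
move=> /allpairsP[[a bc] /= [+ /allpairsP[[b c] /= [+ + ->]] ->]].
rewrite !mem_permutations => pa pb pc.
have sa : size a = p by rewrite (perm_size pa).
have sb : size b = (r - l)%N by rewrite (perm_size pb).
have sc : size c = (r - m)%N by rewrite (perm_size pc).
have sab : size (a ++ b) = m by rewrite size_cat sa sb /p; lia.
split.
- rewrite !cat_uniq !(perm_uniq pa) (perm_uniq pb) (perm_uniq pc) !fset_uniq /= andbT.
  rewrite has_cat negb_or; apply/andP; split; [apply/andP; split|].
  + apply/hasPn => x /=; rewrite (perm_mem pb) (perm_mem pa) !inE.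
    by case/andP => /negbTE ->; rewrite andbF.
  + apply/hasPn => x /=; rewrite (perm_mem pc) (perm_mem pa) !inE.
    by case/andP => /negbTE ->.
  + apply/hasPn => x /=; rewrite (perm_mem pc) (perm_mem pb) !inE.
    by case/andP => /negbTE -> ->.
- by rewrite catA size_cat sab sc; lia.
- apply/fsetP => x; rewrite mem_fst_face catA take_size_cat// mem_cat.
  rewrite (perm_mem pa) (perm_mem pb) !inE.
  by case: (x \in k.1); case: (x \in k.2).
- apply/fsetP => x; rewrite mem_snd_face -/p take_size_cat// catA drop_size_cat//.
  rewrite mem_cat (perm_mem pa) (perm_mem pc) !inE.
  by case: (x \in k.1); case: (x \in k.2).
Qed.

Lemma faces_overlapping s : uniq s -> size s = r ->
  let k := (fst_face s, snd_face s) in overlapping k /\ s \in orderings k.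
Proof.
move=> us ss k.
pose a := take p s; pose b := drop p (take m s); pose c := drop m s.
have pm : (p <= m)%N by rewrite /p; lia.
have tm : take m s = a ++ b.
  by rewrite -(cat_take_drop p (take m s)) -take_min (minn_idPl pm).
have sabc : s = a ++ b ++ c by rewrite catA -tm cat_take_drop.
have sa : size a = p by rewrite size_takel// ss /p; lia.
have sb : size b = (r - l)%N.
  by rewrite size_drop size_takel ?ss// /p; lia.
have sc : size c = (r - m)%N by rewrite size_drop ss.
have k1 : k.1 =i a ++ b by move=> x; rewrite mem_fst_face tm.
have k2 : k.2 =i a ++ c by move=> x; rewrite mem_snd_face.
move: (us); rewrite sabc !cat_uniq has_cat negb_or.
move=> /and3P[ua /andP[/hasPn ab /hasPn ac] /and3P[ub /hasPn bc uc]].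
have inI : k.1 `&` k.2 =i a.
  move=> x; rewrite inE k1 k2 !mem_cat; case xa : (x \in a) => //=.
  apply/negP => /andP[xb xc]; by have := bc _ xc; rewrite /= xb.
have in1 : k.1 `\` k.2 =i b.
  move=> x; rewrite inE k1 k2 !mem_cat; case xb : (x \in b); last first.
    by case: (x \in a); case: (x \in c).
  have /= /negbTE -> := ab _ xb; case xc : (x \in c) => //.
  by have /= := bc _ xc; rewrite xb.
have in2 : k.2 `\` k.1 =i c.
  move=> x; rewrite inE k1 k2 !mem_cat; case xc : (x \in c); last first.
    by case: (x \in a); case: (x \in b).
  have /= /negbTE -> := ac _ xc; by have /= /negbTE -> := bc _ xc.
have uab : uniq (a ++ b) by rewrite cat_uniq ua ub andbT; exact/hasPn.
have uac : uniq (a ++ c) by rewrite cat_uniq ua uc andbT; exact/hasPn.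
have card (A : {fset T}) t : A =i t -> uniq t -> #|` A| = size t.
  by move=> At ut; apply: perm_size; apply: uniq_perm.
split.
  split.
  - by rewrite (card _ _ k1)// size_cat sa sb /p; lia.
  - by rewrite (card _ _ k2)// size_cat sa sc /p; lia.
  - rewrite (card _ s)//.
    by move=> x; rewrite inE k1 k2 sabc !mem_cat; do 3!case: (x \in _).
apply: allpairs_f; last apply: allpairs_f.
- by rewrite mem_permutations; apply: uniq_perm.
- by rewrite mem_permutations; apply: uniq_perm.
- by rewrite mem_permutations; apply: uniq_perm.
Qed.

(** The lists that describe a given pair are the orderings of its intersection
    followed by those of its two differences, whence the factorials. *)
Lemma esum_overlapping (g : {fset T} -> {fset T} -> \bar R) :
  (forall A B, 0 <= g A B) ->
  \esum_(nu in [set: r.-tuple T])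
    (if uniq nu then g (fst_face nu) (snd_face nu) else 0) =
  ((r - m)`! * (r - l)`! * (m + l - r)`!)%N%:R%:E *
  \esum_(k in overlapping) g k.1 k.2.
Proof.
move=> g0.
rewrite -ge0_esumZl// ?lee_fin//.
transitivity (\esum_(k in overlapping) \esum_(s in [set` orderings k]) g k.1 k.2).
  rewrite esum_esum; last by move=> *; exact: g0.
  rewrite (reindex_esum [set nu : r.-tuple T | uniq nu] _
    (fun nu : r.-tuple T => ((fst_face nu, snd_face nu), tval nu))) /=.
    rewrite [RHS]esum_mkcond; apply: eq_esum => nu _.
    by case: ifPn => unu; [rewrite mem_set|rewrite memNset//; exact/negP].
  split.
  - by move=> nu /= unu; exact: faces_overlapping (size_tuple nu).
  - by move=> nu nu' _ _ [_ _ /val_inj].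
  - move=> [k s] /= [ok sk]; have [us ss e1 e2] := mem_orderings k s ok sk.
    have sst : size s == r by rewrite ss.
    by exists (Tuple sst) => //=; rewrite e1 e2; case: k {ok sk e1 e2}.
by apply: eq_esum => k ok; rewrite esum_seq_cst ?uniq_orderings// size_orderings.
Qed.

End overlapping_pairs.

(** * Probability of two simplices *)

Section connection_functions_lemmas.
Context {R : realType} {d} {X : measurableType d} {alpha : nat}.
Context {phi : forall j, j.+1.-tuple X -> R}.
Hypothesis hphi : connection_functions alpha phi.

Lemma connection_atE j (t : j.+1.-tuple X) : connection_at phi t = phi j t.
Proof.
case: t => [[//|x s] /= ss]; have [js] : (size s).+1 = j.+1 by exact/eqP.
by subst j; congr (phi _ _); exact/val_inj.
Qed.

Lemma connection_at1 (s : seq X) : (size s <= 1)%N -> connection_at phi s = 1.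
Proof. by have [phi0 _] := hphi; case: s => [//|x [|//]] _; exact: phi0. Qed.

Lemma connection_at_01 (s : seq X) : (size s <= alpha.+1)%N ->
  0 <= connection_at phi s <= 1.
Proof.
move=> sa; have [s1|s1] := leqP (size s) 1.
  by rewrite connection_at1// ler01 lexx.
case: s sa s1 => [//|x s] /= sa s1.
by have [_ + _] := hphi.2 (size s) (introT andP (conj s1 sa)); exact.
Qed.

Lemma perm_connection_at (s s' : seq X) : (size s <= alpha.+1)%N ->
  perm_eq s s' -> connection_at phi s = connection_at phi s'.
Proof.
move=> sa ss'; have [s1|s1] := leqP (size s) 1.
  by rewrite !connection_at1// -(perm_size ss').
case: s sa s1 ss' => [//|x s] sa s1 ss'.
have szs' : size s' == (size s).+1 by rewrite -(perm_size ss').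
have /tuple_permP[q xsE] : perm_eq (x :: s) (Tuple szs') by [].
have -> : connection_at phi s' = phi (size s) (Tuple szs').
  by rewrite -connection_atE.
rewrite -[x :: s]/(tval [tuple of x :: in_tuple s]) connection_atE.
have [_ _ sym] := hphi.2 (size s) (introT andP (conj s1 sa)).
by rewrite -[RHS](sym _ q); congr (phi _ _); exact/val_inj.
Qed.

Lemma measurable_connection_at {d'} {Y : measurableType d'} {I : Type}
    (u : I -> Y -> X) (e : seq I) : (forall i, measurable_fun setT (u i)) ->
  (size e <= alpha.+1)%N ->
  measurable_fun setT (fun y => connection_at phi [seq u i y | i <- e]).
Proof.
move=> mu; have [e1 _|e1 ea] := leqP (size e) 1.
  rewrite (_ : (fun y => _) = cst 1); first exact: measurable_cst.
  by apply/funext => y; rewrite connection_at1 ?size_map.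
case: e e1 ea => [//|i e] e1 ea.
have [mphi _ _] := hphi.2 (size e) (introT andP (conj e1 ea)).
pose t y : (size e).+1.-tuple X := map_tuple (u ^~ y) [tuple of i :: in_tuple e].
rewrite (_ : (fun y => _) = phi (size e) \o t).
  apply: measurableT_comp mphi _; apply/measurable_fun_tnthP => k.
  rewrite (_ : _ \o _ = u (tnth [tuple of i :: in_tuple e] k)); first exact: mu.
  by apply/funext => y /=; rewrite tnth_map.
by apply/funext => y; rewrite -[RHS]/(phi (size e) (t y)) -connection_atE.
Qed.

End connection_functions_lemmas.

Section independent_marks_map.
Context {R : realType} {d'} {Omega : measurableType d'} {P : probability Omega R}.

Lemma independent_marks_map {I J : eqType} (U : I -> Omega -> R) (f : J -> I)
    {d} {T : measurableType d} (E : set Omega) (Y : Omega -> T) (s : seq J) :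
  {in s &, injective f} ->
  independent_marks P U E Y (map f s) ->
  independent_marks P (fun j => U (f j)) E Y s.
Proof.
move=> finj ind B V mB mV; case: s finj ind => [|j0 s0].
  move=> _ ind; have := ind B (fun=> setT) mB (fun=> measurableT).
  by rewrite !big_nil => <-; congr (P (_ `&` _)); apply/seteqP; split.
move: (j0 :: s0) => s finj ind.
(* [V] is transported along the injection [f]; [j0] is a default value *)
pose V' i := V (nth j0 s (index i (map f s))).
have V'f j : j \in s -> V' (f j) = V j by move=> js; rewrite /V' nth_index_map.
have := ind B V' mB (fun i => mV _); rewrite big_map.
rewrite (eq_big_seq (fun j => uniform_prob (@ltr01 R) (V j))); last first.
  by move=> j js; rewrite /= V'f.
move=> <-; congr (P (_ `&` _)); apply/seteqP; split => w h.
  by move=> i /mapP[j js ->]; rewrite V'f//; exact: h.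
by move=> j js; rewrite -V'f//; apply: h; exact: map_f.
Qed.

End independent_marks_map.

Section two_simplices_lemmas.
Variables (m l r : nat).
Hypothesis mr : (m <= r)%N.
Hypothesis lr : (l <= r)%N.
Hypothesis rml : (r <= m + l)%N.

Lemma card_ord_lt n : (n <= r)%N -> #|[set i : 'I_r | (i < n)%N]%SET| = n.
Proof.
move=> nr; rewrite cardsE -sum1_card (eq_bigl (fun i : 'I_r => (i < n)%N)) => [|i //].
by rewrite (big_ord_narrow nr) sum1_card card_ord.
Qed.

Lemma card_two_simplices s : s \in two_simplices m l r -> (#|s| <= maxn m l)%N.
Proof.
rewrite inE => /andP[_ /orP[] /subset_leq_card sm].
  by rewrite leq_max (leq_trans sm)// card_ord_lt.
rewrite leq_max; apply/orP; right; apply: leq_trans sm _.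
have -> : [set i : 'I_r | (i < m + l - r)%N || (m <= i)%N]%SET =
    ([set i : 'I_r | (i < m + l - r)%N] :|: ~: [set i : 'I_r | (i < m)%N])%SET.
  by apply/setP => i; rewrite !inE -leqNgt.
have := cardsC [set i : 'I_r | (i < m)%N]%SET.
have pr : (m + l - r <= r)%N by lia.
have [leU _] := leq_card_setU [set i : 'I_r | (i < m + l - r)%N]%SET
  (~: [set i : 'I_r | (i < m)%N])%SET.
move=> cC; apply: leq_trans leU _; move: cC.
by rewrite !card_ord_lt// card_ord; move: #|_| => k; lia.
Qed.

End two_simplices_lemmas.

Section random_complex_moments.
Context {R : realType} {d} {X : measurableType d} {d'} {Omega : measurableType d'}.
Context {lambda : {sigma_finite_measure set X -> \bar R}}.
Context {alpha : nat} {beta : R} {phi : forall j : nat, j.+1.-tuple X -> R}.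
Context {P : probability Omega R} {N : Omega -> \bar R} {pt : nat -> Omega -> X}.
Context {U : {fset nat} -> Omega -> R} {W : set X}.
Hypothesis bX : borel_space X R.
Hypothesis diff_lambda : diffuse lambda.
Hypothesis beta_ge0 : 0 <= beta.
Hypothesis hphi : connection_functions alpha phi.
Hypothesis hPhi : enumerated_poisson_process P (fun B => beta%:E * lambda B)%E N pt.
Hypothesis hU : uniform_marks P alpha N pt U.
Hypothesis mW : measurable W.
Hypothesis lambdaW : (lambda W < +oo)%E.
Local Open Scope ereal_scope.

Let mN : measurable_fun setT N. Proof. by have [] := hPhi. Qed.

Let mpt n : measurable_fun setT (pt n). Proof. by have [_ _ + _] := hPhi; exact. Qed.

Let mU K : (2 <= #|` K| <= alpha.+1)%N -> measurable_fun setT (U K).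
Proof. by have [+ _ _] := hU; exact. Qed.

Definition marks_below (K : {fset nat}) : set Omega :=
  [set w | (U K w <= connection_at phi [seq pt n w | n <- K])%R].

Definition simplex_event (J : {fset nat}) : set Omega :=
  [set w | (forall n, n \in J -> hit N pt n W w) /\
    forall K : {fset nat}, (K `<=` J)%fset -> (2 <= #|` K|)%N -> marks_below K w].

Lemma measurable_marks_below K : (2 <= #|` K| <= alpha.+1)%N ->
  measurable (marks_below K).
Proof.
move=> cK; rewrite -[X in measurable X]setTI; apply: measurable_fun_le => //.
  exact: mU.
by apply: (measurable_connection_at hphi) => //; case/andP: cK.
Qed.

Lemma measurable_simplex_event J : (#|` J| <= alpha.+1)%N ->
  measurable (simplex_event J).
Proof.
move=> cJ; apply: measurableI.
  rewrite [X in measurable X](_ : _ = \bigcap_(n in [set` J]) hit N pt n W).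
    by apply: fin_bigcap_measurable => // n _; exact: measurable_hit.
  by apply/seteqP; split => w h n nJ; exact: h.
rewrite [X in measurable X](_ : _ =
    \bigcap_(K in [set K : {fset nat} | K \in fpowerset J /\ (2 <= #|` K|)%N]) marks_below K).
  apply: fin_bigcap_measurable => [|K /= [KJ K2]].
    by apply: (@sub_finite_set _ _ [set` fpowerset J]) => [K []//|].
  apply: measurable_marks_below; rewrite K2 (leq_trans _ cJ)//.
  by apply: fsubset_leq_card; rewrite -fpowersetE.
apply/seteqP; split => w h K; last by move=> KJ K2; apply: h; rewrite /= fpowersetE.
by move=> [KJ K2]; apply: h => //; rewrite -fpowersetE.
Qed.

Section pairs.
Variables (m l r : nat).
Hypothesis mr : (m <= r)%N.
Hypothesis lr : (l <= r)%N.
Hypothesis rml : (r <= m + l)%N.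
Hypothesis ma : (m <= alpha.+1)%N.
Hypothesis la : (l <= alpha.+1)%N.

Let card_face s : s \in two_simplices m l r -> (#|s| <= alpha.+1)%N.
Proof.
move=> /(card_two_simplices m l r mr lr rml) /leq_trans; apply.
by rewrite geq_max ma la.
Qed.

Let h (s : {set 'I_r}) (y : r.-tuple X) : R :=
  connection_at phi [seq tnth y i | i <- enum s].

Let mh s : s \in two_simplices m l r -> measurable_fun setT (h s).
Proof.
move=> /card_face sa; apply: (measurable_connection_at hphi (fun i (y : r.-tuple X) => tnth y i)).
  by move=> i; exact: measurable_tnth.
by rewrite -cardE.
Qed.

Let h01 s y : s \in two_simplices m l r -> (0 <= h s y <= 1)%R.
Proof. by move=> /card_face sa; apply: (connection_at_01 hphi); rewrite size_map -cardE. Qed.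

Lemma kappaE y : kappa phi m l y =
  (\prod_(s <- enum (two_simplices m l r)) h s y)%R.
Proof. by rewrite big_enum. Qed.

Lemma measurable_kappa : measurable_fun setT (@kappa _ X R phi m l r).
Proof.
rewrite (_ : @kappa _ X R phi m l r = fun y : r.-tuple X =>
   (\prod_(s <- enum (two_simplices m l r)) h s y)%R).
  by apply: measurable_prod => s; rewrite mem_enum; exact: mh.
by apply/funext => y; rewrite kappaE.
Qed.

Lemma kappa_01 (y : r.-tuple X) : (0 <= kappa phi m l y <= 1)%R.
Proof.
rewrite kappaE big_seq; apply/andP; split.
  by apply: prodr_ge0 => s; rewrite mem_enum => /(h01 _ y)/andP[].
by apply: prodr_ile1 => s; rewrite mem_enum; exact: h01.
Qed.

Let img (nu : r.-tuple nat) (s : {set 'I_r}) : {fset nat} :=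
  [fset tnth nu i | i in s]%fset.

Let proper_faces : seq {set 'I_r} :=
  seq.filter (fun s : {set 'I_r} => (1 < #|s|)%N) (enum (two_simplices m l r)).

Let kappa_proper y : kappa phi m l y = (\prod_(s <- proper_faces) h s y)%R.
Proof.
rewrite kappaE [RHS]big_filter [RHS]big_mkcond; apply: eq_bigr => s _.
case: leqP => // s1; rewrite /h (connection_at1 hphi)//.
by rewrite size_map -cardE.
Qed.

Let mem_img (nu : r.-tuple nat) (s : {set 'I_r}) i : uniq nu ->
  (tnth nu i \in img nu s) = (i \in s).
Proof.
move=> /tuple_uniqP inj; apply/imfsetP/idP => [[j /= js /inj ->//]|si].
by exists i.
Qed.

Let perm_img (nu : r.-tuple nat) (s : {set 'I_r}) : uniq nu ->
  perm_eq (img nu s) [seq tnth nu i | i <- enum s].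
Proof.
move=> unu; apply: uniq_perm => [||n]; first exact: fset_uniq.
  by rewrite map_inj_uniq ?enum_uniq//; exact/tuple_uniqP.
apply/imfsetP/mapP => [[i /= si ->]|[i]]; first by exists i; rewrite ?mem_enum.
by rewrite mem_enum => si ->; exists i.
Qed.

Let card_img (nu : r.-tuple nat) (s : {set 'I_r}) : uniq nu -> #|` img nu s| = #|s|.
Proof. by move=> unu; rewrite (perm_size (perm_img nu s unu)) size_map -cardE. Qed.

Let mem_fst (nu : r.-tuple nat) i : uniq nu ->
  (tnth nu i \in fst_face m nu) = (i < m)%N.
Proof.
move=> unu; rewrite mem_fst_face in_take ?mem_tnth//.
by rewrite (tnth_nth 0%N) index_uniq// size_tuple.
Qed.

Let mem_snd (nu : r.-tuple nat) i : uniq nu ->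
  (tnth nu i \in snd_face m l r nu) = (i < m + l - r)%N || (m <= i)%N.
Proof.
move=> unu; rewrite mem_snd_face mem_cat in_take ?mem_tnth//.
have idx : index (tnth nu i) nu = i.
  by rewrite (tnth_nth 0%N) index_uniq// size_tuple.
rewrite idx; congr (_ || _).
have : tnth nu i \in take m nu ++ drop m nu by rewrite cat_take_drop mem_tnth.
have : uniq (take m nu ++ drop m nu) by rewrite cat_take_drop.
rewrite cat_uniq => /and3P[_ /hasPn disj _].
rewrite mem_cat in_take ?mem_tnth// idx; case: (ltnP i m) => im /= hd; last by rewrite hd.
by apply/negP => /disj /=; rewrite in_take ?mem_tnth// idx im.
Qed.

Let mem_nu (nu : r.-tuple nat) n : n \in nu -> exists i, n = tnth nu i.
Proof. by move=> /tnthP[i ->]; exists i. Qed.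

Let face_in_nu (nu : r.-tuple nat) n :
  n \in fst_face m nu \/ n \in snd_face m l r nu -> n \in nu.
Proof.
case; first by rewrite mem_fst_face => /mem_take.
by rewrite mem_snd_face mem_cat => /orP[/mem_take|/mem_drop].
Qed.

Let pair_event (nu : r.-tuple nat) : uniq nu ->
  simplex_event (fst_face m nu) `&` simplex_event (snd_face m l r nu) =
  hits N pt W nu `&` points_at pt nu @^-1` setT `&`
  below (fun s => U (img nu s)) h (points_at pt nu) proper_faces.
Proof.
move=> unu.
have belowE s w : s \in two_simplices m l r ->
    h s (points_at pt nu w) = connection_at phi [seq pt n w | n <- img nu s].
  move=> /card_face sa; apply: (perm_connection_at hphi).
    by rewrite size_map -cardE.
  rewrite (_ : [seq tnth _ i | i <- _] = [seq pt n w | n <- [seq tnth nu i | i <- enum s]]).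
    by apply: perm_map; rewrite perm_sym; exact: perm_img.
  by rewrite -map_comp; apply: eq_map => i /=; rewrite tnth_points_at.
apply/seteqP; split => w.
  move=> [[J1 K1] [J2 K2]]; split.
    split => // i; have [im|im] := ltnP i m.
      by apply: J1; rewrite mem_fst.
    by apply: J2; rewrite mem_snd// im orbT.
  move=> s; rewrite mem_filter mem_enum => /andP[s1 s2]; rewrite belowE//.
  have := s2; rewrite inE => /andP[_ /orP[]] /fintype.subsetP sub.
    apply: K1; last by rewrite card_img.
    apply/fsubsetP => n /imfsetP[i /= /sub]; rewrite inE => im ->.
    by rewrite mem_fst.
  apply: K2; last by rewrite card_img.
  apply/fsubsetP => n /imfsetP[i /= /sub]; rewrite inE => im ->.
  by rewrite mem_snd.
move=> [[hw _] bw].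
have key (K : {fset nat}) : (2 <= #|` K|)%N -> (forall n, n \in K -> n \in nu) ->
    [set i | tnth nu i \in K]%SET \in two_simplices m l r -> marks_below K w.
  move=> K2 Knu sK; set s := [set i | tnth nu i \in K]%SET in sK.
  have KE : img nu s = K.
    apply/fsetP => n; apply/imfsetP/idP => [[i /=]|nK]; first by rewrite inE => ? ->.
    by have [i nE] := mem_nu nu n (Knu n nK); exists i; rewrite //= inE -nE.
  have := bw s; rewrite belowE// KE; apply.
  by rewrite mem_filter mem_enum sK -(card_img nu s unu) KE K2.
have neq0 (K : {fset nat}) : (2 <= #|` K|)%N -> (forall n, n \in K -> n \in nu) ->
    [set i | tnth nu i \in K]%SET != finset.set0.
  move=> K2 Knu; have : (0 < #|` K|)%N by rewrite (leq_trans _ K2).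
  rewrite cardfs_gt0 => /fset0Pn[n nK]; apply/set0Pn.
  by have [i nE] := mem_nu nu n (Knu n nK); exists i; rewrite inE -nE.
have hit_nu n : n \in nu -> hit N pt n W w.
  by move=> /(mem_nu nu)[i ->]; exact: hw.
split; split.
- by move=> n nJ; apply: hit_nu; apply: face_in_nu; left.
- move=> K KJ K2; have Knu n : n \in K -> n \in nu.
    by move=> /(fsubsetP KJ) nJ; apply: face_in_nu; left.
  apply: key => //; rewrite inE neq0//=; apply/orP; left; apply/fintype.subsetP => i.
  by rewrite !inE => /(fsubsetP KJ); rewrite mem_fst.
- by move=> n nJ; apply: hit_nu; apply: face_in_nu; right.
- move=> K KJ K2; have Knu n : n \in K -> n \in nu.
    by move=> /(fsubsetP KJ) nJ; apply: face_in_nu; right.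
  apply: key => //; rewrite inE neq0//=; apply/orP; right; apply/fintype.subsetP => i.
  by rewrite !inE => /(fsubsetP KJ); rewrite mem_snd.
Qed.

(** Given the points, [kappa] is the probability that both simplices are
    present: every face with at least two vertices requires one independent mark
    to be small, once only even if it belongs to both simplices, and vertices
    require nothing. *)
Lemma probability_pair (nu : r.-tuple nat) : uniq nu ->
  P (simplex_event (fst_face m nu) `&` simplex_event (snd_face m l r nu)) =
  \int[P]_(w in hits N pt W nu) (kappa phi m l (points_at pt nu w))%:E.
Proof.
move=> unu; rewrite pair_event//.
have proper_card s : s \in proper_faces -> (2 <= #|` img nu s| <= alpha.+1)%N.
  by rewrite mem_filter mem_enum => /andP[s1 /card_face sa]; rewrite card_img// s1 sa.
have img_inj : injective (img nu).
  move=> s s' /fsetP e; apply/setP => i.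
  by have := e (tnth nu i); rewrite !mem_img.
rewrite (@probability_below _ _ _ P _ (fun s => U (img nu s))).
- rewrite preimage_setT setIT; apply: eq_integral => w _.
  by rewrite kappa_proper.
- exact: measurable_hits.
- exact: measurable_points_at.
- by rewrite filter_uniq// enum_uniq.
- by move=> s /proper_card; exact: mU.
- by move=> s; rewrite mem_filter mem_enum => /andP[_]; exact: mh.
- by move=> s y; rewrite mem_filter mem_enum => /andP[_]; exact: h01.
- apply: independent_marks_map; first by move=> s s' _ _; exact: img_inj.
  apply: (independent_marks_points hU mW).
    by rewrite map_inj_uniq// filter_uniq// enum_uniq.
  by move=> K /mapP[s sp ->]; exact: proper_card.
- exact: measurableT.
Qed.

(** Summing over index lists instead of pairs of sets counts each pair as often
    as it has orderings, and makes the factorial moment formula applicable. *)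
Lemma esum_pairs :
  ((r - m)`! * (r - l)`! * (m + l - r)`!)%N%:R%:E *
  (\esum_(k in overlapping m l r) P (simplex_event k.1 `&` simplex_event k.2)) =
  (beta ^+ r)%:E * simplex_integral lambda phi m l r W.
Proof.
rewrite -(esum_overlapping m l r mr lr rml
  (fun A B => P (simplex_event A `&` simplex_event B)))//.
rewrite -(factorial_moment lambda beta_ge0 hPhi bX diff_lambda mW lambdaW r
  (fun y => (kappa phi m l y)%:E)).
- by apply: eq_esum => nu _; case: ifPn => // unu; rewrite probability_pair.
- by apply/measurable_EFinP; exact: measurable_kappa.
- by move=> y; rewrite lee_fin; have /andP[] := kappa_01 y.
Qed.

End pairs.
End random_complex_moments.

(** * Simplex integrals *)

Section power_integrals.
Context {R : realType} {d} {X : measurableType d}.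
Variable lambda : {sigma_finite_measure set X -> \bar R}.
Local Open Scope ereal_scope.

Lemma measurable_cons_tuple n (x : X) :
  measurable_fun setT (fun t : n.-tuple X => [tuple of x :: t]).
Proof.
apply/measurable_fun_tnthP => i; case: (unliftP ord0 i) => [j ->|->].
  rewrite (_ : _ \o _ = fun t => tnth t j); first exact: measurable_tnth.
  by apply/funext => t /=; rewrite tnthS.
by rewrite (_ : _ \o _ = cst x).
Qed.

Lemma integral_power_measureS n (f : n.+1.-tuple X -> \bar R) :
  measurable_fun setT f -> (forall t, 0 <= f t) ->
  \int[power_measure lambda n.+1]_t f t =
  \int[lambda]_x \int[power_measure lambda n]_t f [tuple of x :: t].
Proof.
move=> mf f0.
have -> : \int[power_measure lambda n.+1]_t f t =
    \int[pushforward (lambda \x power_measure lambda n) (@cons_pair _ X n)]_t f t by [].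
rewrite ge0_integral_pushforward//; last exact: measurable_cons_pair.
rewrite preimage_setT fubini_tonelli1//; last by move=> p; exact: f0.
exact: measurableT_comp mf (@measurable_cons_pair _ X n).
Qed.

Definition left_part {m l} (t : (m + l).-tuple X) : m.-tuple X :=
  [tuple tnth t (lshift l i) | i < m].
Definition right_part {m l} (t : (m + l).-tuple X) : l.-tuple X :=
  [tuple tnth t (rshift m i) | i < l].

Lemma measurable_left_part m l : measurable_fun setT (@left_part m l).
Proof.
apply/measurable_fun_tnthP => i; rewrite (_ : _ \o _ = fun t => tnth t (lshift l i)).
  exact: measurable_tnth.
by apply/funext => t /=; rewrite tnth_mktuple.
Qed.

Lemma measurable_right_part m l : measurable_fun setT (@right_part m l).
Proof.
apply/measurable_fun_tnthP => i; rewrite (_ : _ \o _ = fun t => tnth t (rshift m i)).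
  exact: measurable_tnth.
by apply/funext => t /=; rewrite tnth_mktuple.
Qed.

Lemma integral_power_measureD m l (f : m.-tuple X -> \bar R) (g : l.-tuple X -> \bar R) :
  measurable_fun setT f -> measurable_fun setT g ->
  (forall t, 0 <= f t) -> (forall t, 0 <= g t) ->
  \int[power_measure lambda (m + l)]_t (f (left_part t) * g (right_part t)) =
  (\int[power_measure lambda m]_t f t) * (\int[power_measure lambda l]_t g t).
Proof.
elim: m f => [|m IHm] f mf mg f0 g0.
  have -> : \int[power_measure lambda 0]_t f t = f [tuple].
    by rewrite integral_dirac// diracT mul1e.
  rewrite -ge0_integralZl//; apply: eq_integral => t _; congr (_ * _).
    by congr f; rewrite [LHS]tuple0.
  by congr g; apply: eq_from_tnth => i; rewrite tnth_mktuple; congr tnth; exact/val_inj.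
have leftS x (t : (m + l).-tuple X) :
    @left_part m.+1 l [tuple of x :: t] = [tuple of x :: left_part t].
  apply: eq_from_tnth => i; rewrite tnth_mktuple; case: (unliftP ord0 i) => [j ->|->].
    rewrite tnthS tnth_mktuple (_ : lshift l (lift ord0 j) = lift ord0 (lshift l j)); last exact/val_inj.
    by rewrite tnthS.
  by rewrite (_ : lshift l ord0 = ord0)//; exact/val_inj.
have rightS x (t : (m + l).-tuple X) :
    @right_part m.+1 l [tuple of x :: t] = right_part t.
  apply: eq_from_tnth => i; rewrite !tnth_mktuple.
  rewrite (_ : rshift m.+1 i = lift ord0 (rshift m i)); last exact/val_inj.
  by rewrite tnthS.
rewrite -[(m.+1 + l)%N]/((m + l).+1) integral_power_measureS; last 2 first.
- apply: emeasurable_funM.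
    exact: measurableT_comp mf (@measurable_left_part m.+1 l).
  exact: measurableT_comp mg (@measurable_right_part m.+1 l).
- by move=> t; exact: mule_ge0.
have G0 : 0 <= \int[power_measure lambda l]_t g t by exact: integral_ge0.
rewrite integral_power_measureS// muleC -ge0_integralZl//; last 2 first.
- rewrite -[X in measurable_fun _ X]/(fubini_F (power_measure lambda m) (f \o @cons_pair _ X m)).
  apply: measurable_fun_fubini_tonelli_F.
    exact: measurableT_comp mf (@measurable_cons_pair _ X m).
  by move=> p; exact: f0.
- by move=> x _; exact: integral_ge0.
apply: eq_integral => x _; rewrite muleC -IHm//; last first.
  exact: measurableT_comp mf (measurable_cons_tuple m x).
by apply: eq_integral => t _; rewrite leftS rightS.
Qed.

End power_integrals.

Section simplex_integrals.
Context {R : realType} {d} {X : measurableType d} {alpha : nat}.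
Context {phi : forall j, j.+1.-tuple X -> R}.
Hypothesis hphi : connection_functions alpha phi.

Lemma two_simplices_id m : two_simplices m m m = [set s : {set 'I_m} | s != finset.set0]%SET.
Proof.
apply/setP => s; rewrite !inE (_ : s \subset _ = true) ?andbT//.
by apply/fintype.subsetP => i _; rewrite inE.
Qed.

Lemma two_simplices0 m : two_simplices m 0 m = two_simplices m m m.
Proof.
apply/setP => s; rewrite two_simplices_id !inE (_ : s \subset _ = true) ?andbT//.
by apply/fintype.subsetP => i _; rewrite inE.
Qed.

(** An injection of the vertices identifies the faces inside its image with the
    faces of a single simplex. *)
Lemma prod_faces {p r} (f : 'I_p -> 'I_r) (A : {set 'I_r}) (x : r.-tuple X) :
  injective f -> (forall i, (i \in A) = [exists j, i == f j]) -> (p <= alpha.+1)%N ->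
  \prod_(s : {set 'I_r} | (s != finset.set0) && (s \subset A))
    connection_at phi [seq tnth x i | i <- enum s] =
  kappa phi p p [tuple tnth x (f i) | i < p].
Proof.
move=> finj fA pa; rewrite /kappa two_simplices_id.
rewrite (eq_bigl [in (fun s : {set 'I_p} => imset f (mem s)) @:
    [set s : {set 'I_p} | s != finset.set0]]%SET).
  rewrite big_imset/=; last by move=> s s' _ _; exact: imset_inj.
  apply: eq_bigr => s _; apply/esym/(perm_connection_at hphi).
    by rewrite size_map -cardE (leq_trans (max_card _))// card_ord.
  rewrite (_ : [seq _ | i <- enum s] = [seq tnth x i | i <- [seq f i | i <- enum s]]); last first.
    by rewrite -map_comp; apply: eq_map => i /=; rewrite tnth_mktuple.
  apply: perm_map; rewrite perm_sym; apply: uniq_perm.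
  - exact: enum_uniq.
  - by rewrite map_inj_uniq// enum_uniq.
  - move=> i; rewrite mem_enum; apply/imsetP/mapP => [[j js ->]|[j js ->]].
      by exists j => //; rewrite mem_enum.
    by exists j => //; rewrite -(mem_enum s).
move=> s /=; rewrite unfold_in /=; apply/andP/imsetP => [[s0 sA]|[s' s'0 ->]].
  exists (f @^-1: s)%SET.
    rewrite inE; case/set0Pn : s0 => i si; apply/set0Pn.
    have := fintype.subsetP sA i si; rewrite fA => /existsP[j /eqP ij].
    by exists j; rewrite inE -ij.
  apply/setP => i; apply/idP/imsetP => [si|[j]]; last by rewrite inE => ? ->.
  have := fintype.subsetP sA i si; rewrite fA => /existsP[j /eqP ij].
  by exists j => //; rewrite inE -ij.
split.
  rewrite inE in s'0; case/set0Pn : s'0 => j s'j; apply/set0Pn.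
  by exists (f j); apply/imsetP; exists j.
by apply/fintype.subsetP => i /imsetP[j _ ->]; rewrite fA; apply/existsP; exists j.
Qed.

(** Two simplices without common vertex have no common face. *)
Lemma kappa_disjoint m l (x : (m + l).-tuple X) : (m <= alpha.+1)%N -> (l <= alpha.+1)%N ->
  kappa phi m l x = kappa phi m m (left_part x) * kappa phi l l (right_part x).
Proof.
move=> ma la; rewrite -(prod_faces (lshift l) [set i : 'I_(m + l) | (i < m)%N]%SET)//; last 2 first.
- exact: lshift_inj.
- move=> i; rewrite inE; apply/idP/existsP => [im|[j /eqP ->]]; last exact: (ltn_ord j).
  by exists (Ordinal im); apply/eqP/val_inj.
rewrite -(prod_faces (@rshift m l) [set i : 'I_(m + l) | (m <= i)%N]%SET)//; last 2 first.
- exact: rshift_inj.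
- move=> i; rewrite inE; apply/idP/existsP => [im|[j /eqP ->]]; last exact: leq_addr.
  have il : (i - m < l)%N by have := ltn_ord i; lia.
  by exists (Ordinal il); apply/eqP/val_inj => /=; rewrite subnKC.
rewrite /kappa (bigID (fun s : {set 'I_(m + l)} => s \subset [set i : 'I_(m + l) | (i < m)%N]%SET))/=.
congr (_ * _); apply: eq_bigl => s; rewrite inE.
  rewrite -andbA; case: (s != _) => //=.
  by case: (s \subset [set i : 'I_(m + l) | (i < m)%N]%SET); rewrite ?orbT ?andbF.
rewrite subnn -andbA; have -> : [set i : 'I_(m + l) | (i < 0)%N || (m <= i)%N]%SET =
    [set i : 'I_(m + l) | (m <= i)%N]%SET by apply/setP => i; rewrite !inE.
case: (altP (s =P finset.set0)) => //= /set0Pn[i si].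
case sm: (s \subset [set i : 'I_(m + l) | (i < m)%N]%SET) => /=; last by rewrite andbT.
apply/esym/negbTE/negP => /fintype.subsetP /(_ i si).
by have := fintype.subsetP sm i si; rewrite inE => im; rewrite inE leqNgt im.
Qed.

Variable lambda : {sigma_finite_measure set X -> \bar R}.
Variable W : set X.
Hypothesis mW : measurable W.
Local Open Scope ereal_scope.

(** An empty second simplex has no faces. This makes first moments the case
    [l = 0] of second moments. *)
Lemma simplex_integral0 m :
  simplex_integral lambda phi m 0 m W = simplex_integral lambda phi m m m W.
Proof.
by rewrite /simplex_integral; apply: eq_integral => x _; rewrite /kappa two_simplices0.
Qed.

Lemma simplex_integral_disjoint m l : (m <= alpha.+1)%N -> (l <= alpha.+1)%N ->
  simplex_integral lambda phi m l (m + l) W =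
  simplex_integral lambda phi m m m W * simplex_integral lambda phi l l l W.
Proof.
move=> ma la; rewrite /simplex_integral integral_mkcond.
rewrite [X in _ = X * _]integral_mkcond [X in _ = _ * X]integral_mkcond.
have mk p : (p <= alpha.+1)%N -> measurable_fun setT
    ((fun x : p.-tuple X => (kappa phi p p x)%:E) \_ (rect (fun=> W))).
  move=> pa; apply/measurable_restrict => //.
  - exact: measurable_rect.
  - rewrite setTI; apply: measurable_funTS; apply/measurable_EFinP.
    exact: (measurable_kappa hphi p p p (leqnn _) (leqnn _) (leq_addr _ _) pa pa).
have k0 p (x : p.-tuple X) : (p <= alpha.+1)%N ->
    0 <= ((fun x : p.-tuple X => (kappa phi p p x)%:E) \_ (rect (fun=> W))) x.
  move=> pa; rewrite patchE; case: ifPn => // _; rewrite lee_fin.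
  by have /andP[] := kappa_01 hphi p p p (leqnn _) (leqnn _) (leq_addr _ _) pa pa x.
rewrite -integral_power_measureD//; last 4 first.
- exact: mk.
- exact: mk.
- by move=> t; exact: k0.
- by move=> t; exact: k0.
apply: eq_integral => x _; rewrite !patchE.
have -> : (x \in [set x | forall i, W (tnth x i)]) =
   (left_part x \in [set x | forall i, W (tnth x i)]) &&
   (right_part x \in [set x | forall i, W (tnth x i)]).
  apply/idP/andP; rewrite !inE; last move=> [h1 h2] i.
    by move=> h; split => i; rewrite tnth_mktuple.
  rewrite -(splitK i); case: (fintype.split i) => j /=.
    by have := h1 j; rewrite tnth_mktuple.
  by have := h2 j; rewrite tnth_mktuple.
case: (left_part x \in _) => /=; last by rewrite mul0e.
by case: (right_part x \in _); rewrite ?mule0// kappa_disjoint.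
Qed.

Lemma simplex_integral_ge0 m l r : (m <= r)%N -> (l <= r)%N -> (r <= m + l)%N ->
  (m <= alpha.+1)%N -> (l <= alpha.+1)%N ->
  0 <= simplex_integral lambda phi m l r W.
Proof.
move=> mr lr rml ma la; apply: integral_ge0 => x _; rewrite lee_fin.
by have /andP[] := kappa_01 hphi m l r mr lr rml ma la x.
Qed.

Lemma simplex_integral_lty m l r : lambda W < +oo ->
  (m <= r)%N -> (l <= r)%N -> (r <= m + l)%N ->
  (m <= alpha.+1)%N -> (l <= alpha.+1)%N ->
  simplex_integral lambda phi m l r W < +oo.
Proof.
move=> lW mr lr rml ma la.
have k01 x := kappa_01 hphi m l r mr lr rml ma la x.
have mD : measurable (@rect X r (fun=> W)) by exact: measurable_rect.
apply: (@le_lt_trans _ _ (\int[power_measure lambda r]_(x in rect (fun=> W)) cst 1 x)).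
  apply: ge0_le_integral => //.
  - by move=> x _; rewrite lee_fin; have /andP[] := k01 x.
  - by apply/measurable_funTS/measurable_EFinP; exact: (measurable_kappa hphi m l r mr lr rml ma la).
  - by move=> x _; rewrite lee_fin; have /andP[] := k01 x.
rewrite integral_cst// mul1e; apply: (@le_lt_trans _ _ (\prod_(i < r) lambda W)).
  by rewrite -power_measure_rect.
rewrite -ge0_fin_numE; last by apply: prode_ge0.
by apply: prode_fin_num => i _; rewrite ge0_fin_numE.
Qed.

End simplex_integrals.

(** * Moments of the face counts *)

Section face_counts.
Context {R : realType} {d} {X : measurableType d} {d'} {Omega : measurableType d'}.
Context {lambda : {sigma_finite_measure set X -> \bar R}}.
Context {alpha : nat} {beta : R} {phi : forall j : nat, j.+1.-tuple X -> R}.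
Context {P : probability Omega R} {N : Omega -> \bar R} {pt : nat -> Omega -> X}.
Context {U : {fset nat} -> Omega -> R} {W : set X}.
Hypothesis bX : borel_space X R.
Hypothesis diff_lambda : diffuse lambda.
Hypothesis beta_ge0 : 0 <= beta.
Hypothesis hphi : connection_functions alpha phi.
Hypothesis hPhi : enumerated_poisson_process P (fun B => beta%:E * lambda B)%E N pt.
Hypothesis hU : uniform_marks P alpha N pt U.
Hypothesis mW : measurable W.
Hypothesis lambdaW : (lambda W < +oo)%E.
Local Open Scope ereal_scope.

Local Notation simplex := (@simplex_event R d X d' Omega phi N pt U W).

Definition face_count (m : nat) (w : Omega) : \bar R :=
  \esum_(J in [set: {fset nat}]) (\1_[set J | #|` J| = m /\ simplex J w] J : R)%:E.

Lemma face_count_ge0 m w : 0 <= face_count m w.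
Proof. by apply: esum_ge0 => J _; rewrite lee_fin. Qed.

Let measurable_face m J : (m <= alpha.+1)%N ->
  measurable_fun setT (fun w => (\1_[set J | #|` J| = m /\ simplex J w] J : R)%:E).
Proof.
move=> ma; have [Jm|Jm] := eqVneq #|` J| m.
  rewrite (_ : (fun w => _) = (fun w => (\1_(simplex J) w)%:E)).
    apply/measurable_EFinP/measurable_indic; apply: (measurable_simplex_event hphi hPhi hU mW).
    by rewrite Jm.
  by apply/funext => w; congr (_%:E); apply: eq_indic; split => [[]|?].
rewrite (_ : (fun w => _) = cst 0); first exact: measurable_cst.
apply/funext => w; rewrite indicE memNset//= => -[/eqP].
by rewrite (negbTE Jm).
Qed.

Lemma measurable_face_count m : (m <= alpha.+1)%N ->
  measurable_fun setT (face_count m).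
Proof.
move=> ma; apply: measurable_esum => // J.
exact: measurable_face.
Qed.

Let eq_of_mul (c b : R) (x y : \bar R) : (c != 0)%R -> c%:E * x = b%:E * y ->
  x = (b / c)%R%:E * y.
Proof.
move=> c0 e; rewrite mulrC EFinM -muleA -e muleA -EFinM mulVf// mul1e//.
Qed.

(** A product of face counts is a sum over pairs of index sets, which is split
    according to the size [r] of their union. *)
Lemma face_count_moment m l : (m <= alpha.+1)%N -> (l <= alpha.+1)%N ->
  \int[P]_w (face_count m w * face_count l w) =
  \sum_(maxn m l <= r < (m + l).+1)
    (beta ^+ r / ((r - m)`! * (r - l)`! * (m + l - r)`!)%N%:R)%:E *
    simplex_integral lambda phi m l r W.
Proof.
move=> ma la.
pose D := [set k : {fset nat} * {fset nat} | #|` k.1| = m /\ #|` k.2| = l].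
pose pair k w : \bar R := (\1_[set k | D k /\ (simplex k.1 `&` simplex k.2) w] k : R)%:E.
have pairE w : face_count m w * face_count l w = \esum_(k in setT) pair k w.
  rewrite -ge0_esumZr//; last exact: face_count_ge0.
  under eq_esum do rewrite -ge0_esumZl//.
  rewrite esum_esum//.
  rewrite (_ : _ `*`` _ = setT); last by apply/seteqP; split.
  apply: eq_esum => k _; rewrite -EFinM /pair; congr (_%:E).
  rewrite !indicE -natrM mulnb; congr (_%:R)%R; congr nat_of_bool.
  apply/andP/idP; rewrite !inE; first by move=> [[? ?] [? ?]]; do 2 split.
  by move=> [[? ?] [? ?]].
have pair_int k : \int[P]_w pair k w =
    if k \in D then P (simplex k.1 `&` simplex k.2) else 0.
  case: ifPn => [/set_mem kD|kD].
    have [k1 k2] := kD.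
    rewrite (_ : pair k = fun w => (\1_(simplex k.1 `&` simplex k.2) w)%:E).
      rewrite integral_indic ?setIT//.
      by apply: measurableI; apply: (measurable_simplex_event hphi hPhi hU mW); rewrite ?k1 ?k2.
    by apply/funext => w; congr (_%:E); apply: eq_indic; split => [[]|].
  rewrite (_ : pair k = cst 0) ?integral0//.
  by apply/funext => w; rewrite /pair indicE memNset// => -[/mem_set]; rewrite (negbTE kD).
have mpair k : measurable_fun setT (pair k).
  have [kD|kD] := boolP (k \in D).
    have [k1 k2] := set_mem kD.
    rewrite (_ : pair k = fun w => (\1_(simplex k.1 `&` simplex k.2) w)%:E).
      apply/measurable_EFinP/measurable_indic.
      by apply: measurableI; apply: (measurable_simplex_event hphi hPhi hU mW); rewrite ?k1 ?k2.
    by apply/funext => w; congr (_%:E); apply: eq_indic; split => [[]|]//; split => //; exact: set_mem.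
  rewrite (_ : pair k = cst 0)//.
  by apply/funext => w; rewrite /pair indicE memNset// => -[/mem_set]; rewrite (negbTE kD).
under eq_integral do rewrite pairE.
rewrite integral_esum//; last by move=> k w; rewrite lee_fin.
under eq_esum do rewrite pair_int.
transitivity (\esum_(k in [set: {fset nat} * {fset nat}])
    \sum_(maxn m l <= r < (m + l).+1)
      if k \in overlapping m l r then P (simplex k.1 `&` simplex k.2) else 0).
  apply: eq_esum => k _; case: ifPn => kD.
    have [k1 k2] := set_mem kD; pose r := #|` k.1 `|` k.2|%fset.
    have rI : r \in index_iota (maxn m l) (m + l).+1.
      rewrite mem_index_iota geq_max ltnS -k1 -k2 /r.
      by rewrite !fsubset_leq_card ?fsubsetUl ?fsubsetUr//= cardfsU leq_subr.
    rewrite (bigD1_seq r)//= ?iota_uniq// mem_set// big1 ?adde0// => s sr.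
    by rewrite memNset// => -[_ _ /eqP]; rewrite eq_sym (negbTE sr).
  rewrite big1// => r _; rewrite memNset// => -[k1 k2 _].
  by move/negP : kD; apply; apply/mem_set.
rewrite esum_sum; last by move=> k r _ _; case: ifP.
rewrite !big_nat; apply: eq_bigr => r /andP[mlr rml].
rewrite -esum_mkcond; apply: eq_of_mul; first by rewrite pnatr_eq0 -lt0n !muln_gt0 !fact_gt0.
move: mlr; rewrite geq_max => /andP[mr lr].
exact: (esum_pairs bX diff_lambda beta_ge0 hphi hPhi hU mW lambdaW).
Qed.

Lemma face_count0 w : face_count 0 w = 1.
Proof.
rewrite /face_count esum_indic esum_one (_ : [set J | _] = [set fset0]).
  by case: pselect => [?|[]//]; rewrite fset_set1 cardfs1.
apply/seteqP; split => [J [/eqP]|J ->]; first by rewrite cardfs_eq0 => /eqP.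
split; first exact: cardfs0.
split => // K; rewrite fsubset0 => /eqP ->.
by rewrite cardfs0.
Qed.

Lemma expectation_face_count m : (m <= alpha.+1)%N ->
  \int[P]_w face_count m w =
  (beta ^+ m / m`!%:R)%:E * simplex_integral lambda phi m m m W.
Proof.
move=> ma; have := face_count_moment m 0 ma (leq0n _).
under eq_integral do rewrite face_count0 mule1.
rewrite maxn0 addn0 big_nat1 subnn fact0 subn0 mul1n muln1 => ->.
by rewrite simplex_integral0.
Qed.

Lemma face_count_moment_lty m l : (m <= alpha.+1)%N -> (l <= alpha.+1)%N ->
  \int[P]_w (face_count m w * face_count l w) < +oo.
Proof.
move=> ma la; rewrite face_count_moment// big_seq.
apply: lte_sum_pinfty => r; rewrite mem_index_iota geq_max ltnS => /andP[/andP[mr lr] rml].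
rewrite lte_mul_pinfty//.
- by rewrite lee_fin divr_ge0// exprn_ge0.
- exact: (simplex_integral_lty hphi).
Qed.

End face_counts.

(** * The Euler characteristic as a function of face counts *)

Section first_preimage.
Context {I : countType} {T : Type}.
Implicit Types (V : set I) (f : I -> T).

(** One preimage for each value: if points coincide, several index sets give
    the same simplex, and taking the one with the least code counts it once, in
    a measurable way. *)
Definition first_preimage V f : set I :=
  [set J | V J /\ forall J', V J' -> f J' = f J -> (choice.pickle J <= choice.pickle J')%N].

Lemma first_preimage_bij V f : set_bij (first_preimage V f) (f @` V) f.
Proof.
split.
- by move=> J [VJ _]; exists J.
- move=> J J' /set_mem[VJ firstJ] /set_mem[VJ' firstJ'] e.
  apply: (pcan_inj choice.pickleK); apply/eqP; rewrite eqn_leq.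
  by rewrite firstJ// firstJ'.
- move=> _ [J VJ <-].
  pose hits_J n := `[< exists J', [/\ V J', f J' = f J & choice.pickle J' = n] >].
  have ex : exists n, hits_J n by exists (choice.pickle J); apply/asboolP; exists J.
  case: (ex_minnP ex) => _ /asboolP[J' [VJ' fJ' <-]] minJ'.
  exists J' => //; split => // J'' VJ'' fJ''; apply: minJ'.
  by apply/asboolP; exists J''; rewrite fJ''.
Qed.

Lemma first_preimage_inj V f : set_inj V f -> first_preimage V f = V.
Proof.
move=> finj; apply/seteqP; split => [J []//|J VJ]; split => // J' VJ' e.
by rewrite (finj J' J) ?inE.
Qed.

End first_preimage.

Section nb_simplices_lemmas.
Context {X : choiceType} {R : realType}.
Implicit Types (K : set {fset X}) (a : nat -> R).

Let simplices K i : set {fset X} := [set s | K s /\ #|` s| = i.+1].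

Lemma euler_char_finite K a n : finite_set K -> (forall i, (n <= i)%N -> a i = 0) ->
  euler_char a K = \sum_(0 <= i < n) a i * (nb_simplices i K)%:R.
Proof.
move=> fK a0; rewrite /euler_char.
set M := maxn n (max_vertices K).
have widen k : (k <= M)%N ->
    (forall i, (k <= i)%N -> a i * (nb_simplices i K)%:R = 0) ->
    \sum_(0 <= i < k) a i * (nb_simplices i K)%:R =
    \sum_(0 <= i < M) a i * (nb_simplices i K)%:R.
  move=> kM z; rewrite [RHS](@big_cat_nat _ _ _ k)//=.
  rewrite [X in _ = _ + X]big_nat [X in _ = _ + X]big1 ?addr0// => i /andP[ki _].
  exact: z.
rewrite !widen ?leq_maxl ?leq_maxr// => i hi; first by rewrite a0// mul0r.
rewrite /nb_simplices (_ : [set s | _] = set0) ?fset_set0 ?cardfs0 ?mulr0//.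
apply/seteqP; split => // s [Ks si].
have : (#|` s| <= max_vertices K)%N.
  by rewrite /max_vertices; apply: leq_bigmax_seq => //; rewrite in_fset_set// inE.
by rewrite si leqNgt ltnS hi.
Qed.

(** [fset_set] of an infinite set is empty. *)
Lemma euler_char_infinite K a : ~ finite_set K -> euler_char a K = 0.
Proof.
move=> iK; rewrite /euler_char (_ : max_vertices K = 0%N) ?big_geq//.
rewrite /max_vertices (_ : fset_set K = fset0) ?big_seq_fset0//.
by rewrite /fset_set; case: pselect.
Qed.

Lemma finite_complex K n :
  (forall s, K s -> (1 <= #|` s| <= n)%N) ->
  (forall i, (i < n)%N -> finite_set (simplices K i)) <-> finite_set K.
Proof.
move=> K1; split => [h|fK i _]; last by apply: sub_finite_set fK => s [].
rewrite (_ : K = \bigcup_(i in `I_n) simplices K i).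
  by apply: bigcup_finite => // i; exact: h.
apply/seteqP; split => [s Ks|s [i _ []]//].
have /andP[s1 sn] := K1 s Ks.
by exists #|` s|.-1; rewrite /= ?prednK//; split => //; rewrite prednK.
Qed.

(** The counts [S i] may be infinite, and their finiteness decides whether the
    complex is finite; an infinite complex has Euler characteristic 0. This form
    exhibits the Euler characteristic as a measurable function of the counts. *)
Lemma euler_charE K a n (S : nat -> \bar R) :
  (forall s, K s -> (1 <= #|` s| <= n)%N) ->
  (forall i, (n <= i)%N -> a i = 0) ->
  (forall i, (i < n)%N -> S i = \esum_(s in simplices K i) 1%E) ->
  euler_char a K =
  if [forall i : 'I_n, (S i < +oo)%E] then \sum_(0 <= i < n) a i * fine (S i) else 0.
Proof.
move=> K1 a0 SE.
have Sfin i : (i < n)%N -> (S i < +oo)%E <-> finite_set (simplices K i).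
  by move=> /SE ->; rewrite esum_one; case: pselect => h; rewrite ?ltry ?ltxx.
case: ifPn => [/forallP fS|/negP nS].
  have fK : finite_set K.
    by apply/(finite_complex K n K1) => i ni; apply/Sfin => //; exact: (fS (Ordinal ni)).
  rewrite (euler_char_finite K a n fK a0) !big_nat; apply: eq_bigr => i /andP[_ ni].
  rewrite SE// esum_one; case: pselect => // -[]; apply: sub_finite_set fK => s [].
  by [].
apply: euler_char_infinite => /(finite_complex K n K1) fK; apply: nS.
by apply/forallP => i; apply/Sfin => //; exact: fK.
Qed.

End nb_simplices_lemmas.

Section euler_characteristic.
Context {R : realType} {d} {X : measurableType d} {d'} {Omega : measurableType d'}.
Context {alpha : nat} {phi : forall j : nat, j.+1.-tuple X -> R}.
Context {N : Omega -> \bar R} {pt : nat -> Omega -> X}.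
Context {U : {fset nat} -> Omega -> R} {W : set X}.
Local Notation simplex := (@simplex_event R d X d' Omega phi N pt U W).

Let complex w := subcomplex W (random_complex alpha phi N pt U w).

Definition vertices (w : Omega) (J : {fset nat}) : {fset X} :=
  [fset pt n w | n in J]%fset.

Definition faithful_faces (m : nat) (w : Omega) : set {fset nat} :=
  [set J | [/\ #|` J| = m, simplex J w & #|` vertices w J| = #|` J|] ].

Lemma simplices_faithful i w : (i < alpha.+1)%N ->
  [set s | complex w s /\ #|` s| = i.+1] = vertices w @` faithful_faces i.+1 w.
Proof.
move=> ia; apply/seteqP; split => s.
  move=> [[[_ [J [JN sE sJ marks]]] sW] si]; exists J => //.
  split; first by rewrite -sJ.
  - split => // n nJ; split; first exact: JN.
    by apply: sW; rewrite /= sE; apply/imfsetP; exists n.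
  - by rewrite /vertices -sE.
move=> [J [Ji [hit_J marks_J] vJ] <-]; split; last by rewrite vJ.
split.
  split; first by rewrite vJ Ji.
  exists J; split => //.
    by move=> n /hit_J[].
by move=> _ /imfsetP[n /= /hit_J[_ nW] ->].
Qed.

Definition simplex_count i w : \bar R :=
  \esum_(J in [set: {fset nat}])
    (\1_(first_preimage (faithful_faces i.+1 w) (vertices w)) J : R)%:E.

Lemma simplex_countE i w : (i < alpha.+1)%N ->
  simplex_count i w = \esum_(s in [set s | complex w s /\ #|` s| = i.+1]) 1%E.
Proof.
move=> ia; rewrite /simplex_count esum_indic simplices_faithful//.
by rewrite (reindex_esum _ _ _ _ (first_preimage_bij (faithful_faces i.+1 w) (vertices w))).
Qed.

Lemma euler_char_complexE (a : nat -> R) w : (forall i, (alpha < i)%N -> a i = 0) ->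
  euler_char a (complex w) =
  if [forall i : 'I_alpha.+1, (simplex_count i w < +oo)%E]
  then \sum_(0 <= i < alpha.+1) a i * fine (simplex_count i w) else 0.
Proof.
move=> a0; apply: euler_charE => //; first by move=> s [[]].
by move=> i ia; exact: simplex_countE.
Qed.

Hypothesis bX : borel_space X R.
Hypothesis mpt : forall n, measurable_fun setT (pt n).
Hypothesis msimplex : forall J, (#|` J| <= alpha.+1)%N -> measurable (simplex J).

Let measurable_sub (J J' : {fset nat}) :
  measurable [set w | (vertices w J `<=` vertices w J')%fset].
Proof.
rewrite (_ : [set w | _] = \bigcap_(n in [set` J]) \bigcup_(m in [set` J'])
    [set w | pt n w = pt m w]).
  apply: fin_bigcap_measurable => // n _; apply: fin_bigcup_measurable => // m _.
  exact: (measurable_eq_points _ _ bX).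
apply/seteqP; split => w.
  move=> /= /fsubsetP sub n nJ.
  have : pt n w \in vertices w J by apply/imfsetP; exists n.
  by move=> /sub /imfsetP[m /= mJ' e]; exists m.
move=> h; apply/fsubsetP => _ /imfsetP[n /= nJ ->].
by have [m mJ' /= ->] := h n nJ; apply/imfsetP; exists m.
Qed.

Let measurable_eq_vertices (J J' : {fset nat}) :
  measurable [set w | vertices w J = vertices w J'].
Proof.
rewrite (_ : [set w | _] = [set w | (vertices w J `<=` vertices w J')%fset] `&`
    [set w | (vertices w J' `<=` vertices w J)%fset]); first by apply: measurableI; exact: measurable_sub.
apply/seteqP; split => w /=; first by move=> ->; rewrite fsubset_refl.
by move=> [s1 s2]; apply/eqP; rewrite eqEfsubset s1 s2.
Qed.

Let measurable_injective (J : {fset nat}) :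
  measurable [set w | #|` vertices w J| = #|` J|].
Proof.
rewrite (_ : [set w | _] = \bigcap_(n in [set` J]) \bigcap_(m in [set m | m \in J /\ n != m])
    ~` [set w | pt n w = pt m w]).
  apply: fin_bigcap_measurable => // n _; apply: fin_bigcap_measurable => [|m _].
    by apply: (@sub_finite_set _ _ [set` J]) => // m [].
  by apply: measurableC; exact: (measurable_eq_points _ _ bX).
apply/seteqP; split => w /=.
  move=> /eqP /card_in_imfsetP inj n nJ m [mJ nm] e.
  by move/eqP : nm; apply; exact: inj.
move=> h; apply/eqP/card_in_imfsetP => n m nJ mJ e.
by apply/eqP/negPn/negP => nm; exact: (h n nJ m).
Qed.

Let measurable_faithful m J : (m <= alpha.+1)%N ->
  measurable [set w | faithful_faces m w J].
Proof.
move=> ma; have [Jm|Jm] := eqVneq #|` J| m.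
  rewrite (_ : [set w | _] = simplex J `&` [set w | #|` vertices w J| = #|` J|]).
    apply: measurableI; last exact: measurable_injective.
    by apply: msimplex; rewrite Jm.
  by apply/seteqP; split => w [].
rewrite (_ : [set w | _] = set0)//.
by apply/seteqP; split => // w [/eqP]; rewrite (negbTE Jm).
Qed.

(** An index set is selected if none of the countably many sets with a smaller
    code gives the same simplex. *)
Lemma measurable_simplex_count i : (i < alpha.+1)%N ->
  measurable_fun setT (simplex_count i).
Proof.
move=> ia; apply: measurable_esum => // J.
pose earlier J' := [set w | faithful_faces i.+1 w J'] `&`
  [set w | vertices w J' = vertices w J].
rewrite (_ : (fun w => _) = (fun w => (\1_([set w | faithful_faces i.+1 w J] `\`
    \bigcup_(J' in [set J' : {fset nat} | (choice.pickle J' < choice.pickle J)%N]) earlier J') w : R)%:E)).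
  apply/measurable_EFinP/measurable_indic; apply: measurableD; first exact: measurable_faithful.
  rewrite bigcup_mkcond; apply: countable_bigcupT_measurable => // J'.
  case: ifPn => // _; apply: measurableI; last exact: measurable_eq_vertices.
  exact: measurable_faithful.
apply/funext => w; congr (_%:E); apply: eq_indic; split.
  move=> [VJ firstJ]; split => // -[J' /= J'J [VJ' e]].
  by move: J'J; rewrite ltnNge firstJ.
move=> [VJ noJ]; split => // J' VJ' e; rewrite leqNgt; apply/negP => J'J.
by apply: noJ; exists J'.
Qed.

Lemma measurable_euler_char (a : nat -> R) : (forall i, (alpha < i)%N -> a i = 0) ->
  measurable_fun setT (fun w => euler_char a (complex w)).
Proof.
move=> a0; under eq_fun do rewrite euler_char_complexE//.
have mS (i : 'I_alpha.+1) := measurable_simplex_count i (ltn_ord i).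
apply: measurable_fun_ifT => //.
  apply: (@measurable_fun_bool _ _ _ _ true).
  rewrite setTI (_ : _ @^-1` _ =
      \bigcap_(i in [set: 'I_alpha.+1]) [set w | (simplex_count i w < +oo)%E]).
    apply: fin_bigcap_measurable => // i _.
    by rewrite -[X in measurable X]setTI; exact: emeasurable_fun_infty_o.
  apply/seteqP; split => w /=; first by move/forallP => h i _; exact: h.
  by move=> h; apply/forallP => i; exact: h.
under eq_fun do rewrite big_mkord.
apply: measurable_sum => i; apply: measurable_funM => //.
exact: measurableT_comp (fine_measurable measurableT) (mS i).
Qed.

(** Away from coinciding points, the simplices are in bijection with the sets
    of indices of their vertices. *)
Lemma simplex_count_faces i w : ~ @double_point _ _ _ _ _ N pt W w ->
  simplex_count i w = face_count (phi := phi) (N := N) (pt := pt) (U := U) (W := W) i.+1 w.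
Proof.
move=> nd; have inj n m : hit N pt n W w -> hit N pt m W w -> pt n w = pt m w -> n = m.
  move=> hn hm e; apply/eqP/negPn/negP => nm; apply: nd.
  by exists n => //; exists m.
rewrite /simplex_count /face_count first_preimage_inj.
  apply: eq_esum => J _; congr (_%:E); apply: eq_indic; split => [[? ? _]//|[Ji sJ]].
  split => //; apply/eqP/card_in_imfsetP => n m /sJ.1 hn /sJ.1 hm; exact: inj.
move=> J J' /set_mem[_ [hJ _] _] /set_mem[_ [hJ' _] _] /fsetP e; apply/fsetP => n.
apply/idP/idP => nJ.
  have : pt n w \in vertices w J by apply/imfsetP; exists n.
  by rewrite e => /imfsetP[m /= mJ' /(inj _ _ (hJ _ nJ) (hJ' _ mJ')) ->].
have : pt n w \in vertices w J' by apply/imfsetP; exists n.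
by rewrite -e => /imfsetP[m /= mJ' /(inj _ _ (hJ' _ nJ) (hJ _ mJ')) ->].
Qed.

End euler_characteristic.

(** * Expectation and variance *)

Section linear_combination.
Context {R : realType} {d} {T : measurableType d} {P : probability T R}.
Context {n : nat} {F : 'I_n -> T -> \bar R} {a : 'I_n -> R} {Y : T -> R}.
Local Open Scope ereal_scope.
Hypothesis mF : forall i, measurable_fun setT (F i).
Hypothesis F0 : forall i w, 0 <= F i w.
Hypothesis F_lty : forall i, \int[P]_w F i w < +oo.
Hypothesis FF_lty : forall i j, \int[P]_w (F i w * F j w) < +oo.
Hypothesis mY : measurable_fun setT Y.
Hypothesis aeY : {ae P, forall w, (forall i, F i w < +oo) ->
  Y w = (\sum_(i < n) a i * fine (F i w))%R}.

Let g i w : R := fine (F i w).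

Let mg i : measurable_fun setT (g i).
Proof. exact: measurableT_comp (fine_measurable measurableT) (mF i). Qed.

Let integrableF i : P.-integrable setT (F i).
Proof.
apply/integrableP; split => //.
by under eq_integral do rewrite gee0_abs//.
Qed.

Let integrableFF i j : P.-integrable setT (fun w => F i w * F j w).
Proof.
apply/integrableP; split; first exact: emeasurable_funM.
by under eq_integral do rewrite gee0_abs ?mule_ge0//.
Qed.

Let fine_le (x : \bar R) : 0 <= x -> (fine x)%:E <= x.
Proof. by case: x => //= *; rewrite leey. Qed.

Let g0 i w : (0 <= g i w)%R. Proof. exact: fine_ge0. Qed.

Let integrable_g i : P.-integrable setT (fun w => (g i w)%:E).
Proof.
apply: le_integrable (integrableF i) => //.
  exact/measurable_EFinP.
by move=> w _; rewrite !gee0_abs ?fine_le// lee_fin.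
Qed.

Let integrable_gg i j : P.-integrable setT (fun w => (g i w * g j w)%:E).
Proof.
apply: le_integrable (integrableFF i j) => //.
  by apply/measurable_EFinP; exact: measurable_funM.
move=> w _; rewrite !gee0_abs ?mule_ge0//; last by rewrite lee_fin mulr_ge0.
by rewrite EFinM lee_pmul ?lee_fin// fine_le.
Qed.

Let ae_fin : {ae P, forall w, forall i, F i w \is a fin_num}.
Proof.
have : {ae P, forall w, forall i, i \in enum 'I_n -> F i w \is a fin_num}.
  elim: (enum 'I_n) => [|i s IHs]; first by apply: aeW => w i.
  apply: filterS2 IHs (integrable_ae measurableT (integrableF i)) => w Fs Fi j.
  by rewrite inE => /orP[/eqP ->|]; [exact: Fi|exact: Fs].
by apply: filterS => w Fw i; apply: Fw; rewrite mem_enum.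
Qed.

Let int_g i : \int[P]_w (g i w)%:E = \int[P]_w F i w.
Proof.
apply: ae_eq_integral => //; first exact/measurable_EFinP.
by apply: filterS ae_fin => w Fw _; rewrite fineK.
Qed.

Let int_gg i j : \int[P]_w (g i w * g j w)%:E = \int[P]_w (F i w * F j w).
Proof.
apply: ae_eq_integral => //.
- by apply/measurable_EFinP; exact: measurable_funM.
- exact: emeasurable_funM.
- by apply: filterS ae_fin => w Fw _; rewrite EFinM !fineK.
Qed.

Let aeYg : {ae P, forall w, Y w = (\sum_(i < n) a i * g i w)%R}.
Proof.
apply: filterS2 ae_fin aeY => w Fw; apply => i.
by rewrite -ge0_fin_numE.
Qed.

Let int_sum : P.-integrable setT (fun w => \sum_(i < n) (a i)%:E * (g i w)%:E) /\
  \int[P]_w (\sum_(i < n) (a i)%:E * (g i w)%:E) = \sum_(i < n) (a i)%:E * \int[P]_w F i w.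
Proof.
have h i : P.-integrable setT (fun w => (a i)%:E * (g i w)%:E).
  exact: integrableZl.
split; first exact: integrable_sum.
rewrite integral_sum//; apply: eq_bigr => i _.
by rewrite integralZl// int_g.
Qed.

Let int_sum2 :
  P.-integrable setT (fun w => \sum_(i < n) \sum_(j < n) (a i * a j)%:E * (g i w * g j w)%:E) /\
  \int[P]_w (\sum_(i < n) \sum_(j < n) (a i * a j)%:E * (g i w * g j w)%:E) =
  \sum_(i < n) \sum_(j < n) (a i * a j)%:E * \int[P]_w (F i w * F j w).
Proof.
have h i j : P.-integrable setT (fun w => (a i * a j)%:E * (g i w * g j w)%:E).
  exact: integrableZl.
have h' i : P.-integrable setT (fun w => \sum_(j < n) (a i * a j)%:E * (g i w * g j w)%:E).
  exact: integrable_sum.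
split; first exact: integrable_sum.
rewrite integral_sum//; apply: eq_bigr => i _.
rewrite integral_sum//; apply: eq_bigr => j _.
by rewrite integralZl// int_gg.
Qed.

Let ae_integrable (f h : T -> \bar R) : measurable_fun setT f -> {ae P, forall w, h w = f w} ->
  P.-integrable setT h -> P.-integrable setT f.
Proof.
move=> mf hf /integrableP[mh ih]; apply/integrableP; split => //.
rewrite (_ : \int[P]_x `|f x| = \int[P]_x `|h x|)//.
apply: ae_eq_integral => //; [exact: measurableT_comp|exact: measurableT_comp|].
by apply: filterS hf => w -> _.
Qed.

Let aeYE : {ae P, forall w, \sum_(i < n) (a i)%:E * (g i w)%:E = (Y w)%:E}.
Proof. by apply: filterS aeYg => w ->; rewrite -sumEFin. Qed.

Let aeYYE : {ae P, forall w,
  \sum_(i < n) \sum_(j < n) (a i * a j)%:E * (g i w * g j w)%:E = (Y w * Y w)%:E}.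
Proof.
apply: filterS aeYg => w ->; rewrite mulr_suml -sumEFin; apply: eq_bigr => i _.
rewrite mulr_sumr -sumEFin; apply: eq_bigr => j _.
by rewrite -EFinM mulrACA.
Qed.

(** The counts [F i] are integrable, hence almost surely finite, so that [Y] is
    almost surely a linear combination of real random variables. *)
Lemma expectation_linear_combination :
  'E_P[Y] = \sum_(i < n) (a i)%:E * \int[P]_w F i w.
Proof.
rewrite unlock -int_sum.2; apply: ae_eq_integral => //.
- exact/measurable_EFinP.
- exact: measurable_int int_sum.1.
- by apply: filterS aeYE => w ->.
Qed.

Lemma variance_linear_combination :
  'V_P[Y] = \sum_(i < n) \sum_(j < n)
    (a i * a j)%:E * (\int[P]_w (F i w * F j w) - \int[P]_w F i w * \int[P]_w F j w).
Proof.
have mYY : measurable_fun setT (fun w => (Y w * Y w)%:E).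
  by apply/measurable_EFinP; exact: measurable_funM.
have iY : Y \in Lfun P 1.
  apply/Lfun1_integrable; apply: ae_integrable aeYE int_sum.1.
  exact/measurable_EFinP.
have iYY : (Y * Y)%R \in Lfun P 1.
  by apply/Lfun1_integrable; exact: (ae_integrable _ _ mYY aeYYE int_sum2.1).
rewrite /variance covarianceE//.
have -> : 'E_P[Y * Y] = \sum_(i < n) \sum_(j < n) (a i * a j)%:E * \int[P]_w (F i w * F j w).
  rewrite unlock -int_sum2.2; apply: ae_eq_integral => //.
  - exact: measurable_int int_sum2.1.
  - by apply: filterS aeYYE => w ->.
rewrite expectation_linear_combination.
have finF i : \int[P]_w F i w = (fine (\int[P]_w F i w))%:E.
  by rewrite fineK// ge0_fin_numE// integral_ge0.
have finFF i j : \int[P]_w (F i w * F j w) = (fine (\int[P]_w (F i w * F j w)))%:E.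
  by rewrite fineK// ge0_fin_numE// integral_ge0// => w _; exact: mule_ge0.
under eq_bigr do under eq_bigr do rewrite finFF -EFinM.
under [X in _ - X * _]eq_bigr do rewrite finF -EFinM.
under [X in _ - _ * X]eq_bigr do rewrite finF -EFinM.
under [RHS]eq_bigr => i _ do under eq_bigr => j _ do
  rewrite (finFF i j) (finF i) (finF j) -[X in _ - X]EFinM -EFinB -EFinM.
under eq_bigr do rewrite sumEFin.
under [RHS]eq_bigr do rewrite sumEFin.
rewrite !sumEFin -EFinM -EFinB; congr (_%:E).
rewrite mulr_suml -sumrB; apply: eq_bigr => i _.
rewrite mulr_sumr -sumrB; apply: eq_bigr => j _.
by rewrite mulrBr mulrACA.
Qed.

End linear_combination.

Section covariance_of_face_counts.
Context {R : realType} {d} {X : measurableType d} {d'} {Omega : measurableType d'}.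
Context {lambda : {sigma_finite_measure set X -> \bar R}}.
Context {alpha : nat} {beta : R} {phi : forall j : nat, j.+1.-tuple X -> R}.
Context {P : probability Omega R} {N : Omega -> \bar R} {pt : nat -> Omega -> X}.
Context {U : {fset nat} -> Omega -> R} {W : set X}.
Hypothesis bX : borel_space X R.
Hypothesis diff_lambda : diffuse lambda.
Hypothesis beta_ge0 : 0 <= beta.
Hypothesis hphi : connection_functions alpha phi.
Hypothesis hPhi : enumerated_poisson_process P (fun B => beta%:E * lambda B)%E N pt.
Hypothesis hU : uniform_marks P alpha N pt U.
Hypothesis mW : measurable W.
Hypothesis lambdaW : (lambda W < +oo)%E.
Local Open Scope ereal_scope.

Local Notation count := (@face_count R d X d' Omega phi N pt U W).

Lemma face_count_lty m : (m <= alpha.+1)%N -> \int[P]_w count m w < +oo.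
Proof.
move=> ma; have := face_count_moment_lty bX diff_lambda beta_ge0 hphi hPhi hU mW
  lambdaW m 0 ma (leq0n _).
by under eq_integral do rewrite face_count0 mule1.
Qed.

(** The summand [r = m + l] of the mixed moment comes from pairs of simplices
    without common vertex; its integral factorises, so that it equals the product
    of the expectations. *)
Lemma face_count_covariance m l : (m <= alpha.+1)%N -> (l <= alpha.+1)%N ->
  \int[P]_w (count m w * count l w) - \int[P]_w count m w * \int[P]_w count l w =
  \sum_(maxn m l <= r < m + l)
    (beta ^+ r / ((r - m)`! * (r - l)`! * (m + l - r)`!)%N%:R)%:E *
    simplex_integral lambda phi m l r W.
Proof.
move=> ma la.
have fin_prod : \int[P]_w count m w * \int[P]_w count l w \is a fin_num.
  rewrite fin_numM// ge0_fin_numE ?face_count_lty//;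
    by apply: integral_ge0 => w _; exact: face_count_ge0.
rewrite (face_count_moment bX diff_lambda beta_ge0 hphi hPhi hU mW lambdaW)//.
rewrite big_nat_recr/=; last by rewrite geq_max leq_addr leq_addl.
rewrite [X in _ + X - _](_ : _ = \int[P]_w count m w * \int[P]_w count l w).
  by rewrite addeK.
rewrite !(expectation_face_count bX diff_lambda beta_ge0 hphi hPhi hU mW lambdaW)//.
rewrite (simplex_integral_disjoint hphi lambda W mW)//.
rewrite muleACA -EFinM; congr (_%:E * _).
rewrite addKn addnK subnn fact0 muln1 natrM exprD invfM.
by rewrite [X in (_ * X)%R]mulrC mulrACA.
Qed.

End covariance_of_face_counts.

Theorem corollary4p4 (R : realType)
    (d : measure_display) (X : measurableType d)
    (lambda : {sigma_finite_measure set X -> \bar R})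
    (alpha : nat) (beta : R) (phi : forall j : nat, j.+1.-tuple X -> R)
    (d' : measure_display) (Omega : measurableType d')
    (P : probability Omega R)
    (N : Omega -> \bar R) (pt : nat -> Omega -> X)
    (U : {fset nat} -> Omega -> R)
    (hX : borel_space X R)
    (hlambda : diffuse lambda)
    (halpha : (1 <= alpha)%N)
    (hbeta : 0 < beta)
    (hphi : connection_functions alpha phi)
    (hPhi : enumerated_poisson_process P (fun B => beta%:E * lambda B)%E N pt)
    (hU : uniform_marks P alpha N pt U)
    (W : set X)
    (hW : measurable W)
    (hlambdaW : (0 < lambda W < +oo)%E)
    (a : nat -> R)
    (ha : forall i : nat, (alpha < i)%N -> a i = 0) :
  let chi := fun w : Omega =>
    euler_char a (subcomplex W (random_complex alpha phi N pt U w)) in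
  let I := fun m l r : nat => simplex_integral lambda phi m l r W in
  [/\ measurable_fun setT chi,
      ('E_P[chi] =
         \sum_(1 <= m < alpha.+2)
           (a m.-1 * (beta ^+ m / m`!%:R))%:E * I m m m)%E &
      ('V_P[chi] =
         \sum_(1 <= m < alpha.+2) \sum_(1 <= l < alpha.+2)
           \sum_(maxn m l <= r < m + l)
             (a m.-1 * a l.-1 *
                (beta ^+ r /
                   ((r - m)`! * (r - l)`! * (m + l - r)`!)%N%:R))%:E *
             I m l r)%E].
Proof.
move=> chi I.
have beta_ge0 : 0 <= beta by exact: ltW.
have /andP[_ lambdaW] := hlambdaW.
have [mN _ mpt _] := hPhi.
have mchi : measurable_fun setT chi.
  apply: measurable_euler_char => //.
  by move=> J; exact: (measurable_simplex_event hphi hPhi hU hW).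
pose F (i : 'I_alpha.+1) := @face_count R d X d' Omega phi N pt U W i.+1.
have mF i : measurable_fun setT (F i).
  exact: (measurable_face_count hphi hPhi hU hW _ (ltn_ord i)).
have F0 i w : (0 <= F i w)%E by exact: face_count_ge0.
have Foo i : (\int[P]_w F i w < +oo)%E.
  exact: (face_count_lty hX hlambda beta_ge0 hphi hPhi hU hW lambdaW _ (ltn_ord i)).
have FFoo i j : (\int[P]_w (F i w * F j w) < +oo)%E.
  exact: (face_count_moment_lty hX hlambda beta_ge0 hphi hPhi hU hW lambdaW _ _ (ltn_ord i) (ltn_ord j)).
have ae_chi : {ae P, forall w, (forall i, (F i w < +oo)%E) ->
    chi w = \sum_(i < alpha.+1) a i * fine (F i w)}.
  exists (@double_point _ _ _ _ _ N pt W); split.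
  - exact: (measurable_double_point lambda hPhi hX hW).
  - exact: (double_point_null lambda beta_ge0 hPhi hX hlambda hW lambdaW).
  - move=> w /= nchi; apply: contrapT => nd; apply: nchi => Fw.
    rewrite /chi euler_char_complexE// big_mkord ifT.
      by apply: eq_bigr => i _; rewrite simplex_count_faces.
    by apply/forallP => i; rewrite simplex_count_faces//; exact: Fw.
split => //.
  rewrite (expectation_linear_combination mF F0 Foo mchi ae_chi).
  rewrite big_add1/= big_mkord; apply: eq_bigr => i _.
  rewrite (expectation_face_count hX hlambda beta_ge0 hphi hPhi hU hW lambdaW _ (ltn_ord i)).
  by rewrite muleA.
rewrite (variance_linear_combination mF F0 Foo FFoo mchi ae_chi).
rewrite [RHS]big_add1/= big_mkord; apply: eq_bigr => i _.
rewrite [RHS]big_add1/= big_mkord; apply: eq_bigr => j _.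
rewrite (face_count_covariance hX hlambda beta_ge0 hphi hPhi hU hW lambdaW
  _ _ (ltn_ord i) (ltn_ord j)).
rewrite [in LHS]big_nat [RHS]big_nat.
rewrite ge0_sume_distrr; last first.
  move=> r /andP[]; rewrite geq_max => /andP[mr lr] rml.
  apply: mule_ge0; first by rewrite lee_fin divr_ge0// exprn_ge0.
  apply: (simplex_integral_ge0 hphi) => //; exact: ltnW.
by apply: eq_bigr => r _; rewrite muleA -EFinM.
Qed.
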